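(* Let $\mathcal{A}$ be a unital $C^*$-algebra, let $f: [0,1] \to B^a(H_{\mathcal{A}})$ be continuous (for the norm topology) and assume that $f([0,1]) \subseteq \mathcal{M}\Phi_{\pm}(H_{\mathcal{A}})$. Then: (1) if $f(0) \in \mathcal{M}\Phi_+(H_{\mathcal{A}}) \setminus \mathcal{M}\Phi(H_{\mathcal{A}})$, then $f(1) \in \mathcal{M}\Phi_+(H_{\mathcal{A}}) \setminus \mathcal{M}\Phi(H_{\mathcal{A}})$; (2) if $f(0) \in \mathcal{M}\Phi_-(H_{\mathcal{A}}) \setminus \mathcal{M}\Phi(H_{\mathcal{A}})$, then $f(1) \in \mathcal{M}\Phi_-(H_{\mathcal{A}}) \setminus \mathcal{M}\Phi(H_{\mathcal{A}})$; (3) if $f(0) \in \mathcal{M}\Phi(H_{\mathcal{A}})$, then $f(1) \in \mathcal{M}\Phi(H_{\mathcal{A}})$ and $\operatorname{index} f(0) = \operatorname{index} f(1)$.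
   Context: $\mathcal{A}$ is a unital $C^*$-algebra; $H_{\mathcal{A}} = \ell^2(\mathcal{A})$ is the standard Hilbert $\mathcal{A}$-module, and $B^a(H_{\mathcal{A}})$ is the $C^*$-algebra of bounded adjointable $\mathcal{A}$-linear operators on it. $M \tilde\oplus N$ denotes a direct sum of closed submodules that is not necessarily orthogonal. A Hilbert module is finitely generated if it is the (algebraic) $\mathcal{A}$-linear span of a finite set. An isomorphism of Hilbert modules is a bounded $\mathcal{A}$-linear bijection (with bounded inverse). For $F \in B^a(H_{\mathcal{A}})$ consider closed submodules with $H_{\mathcal{A}} = M_1 \tilde\oplus N_1 = M_2 \tilde\oplus N_2$, $F(M_1) \subseteq M_2$, $F(N_1) \subseteq N_2$ and $F|_{M_1}: M_1 \to M_2$ an isomorphism. $F \in \mathcal{M}\Phi_+(H_{\mathcal{A}})$ if such a decomposition exists with $N_1$ finitely generated; $F \in \mathcal{M}\Phi_-(H_{\mathcal{A}})$ if such a decomposition exists with $N_2$ finitely generated; $F \in \mathcal{M}\Phi(H_{\mathcal{A}})$ if a single such decomposition exists with both $N_1$ and $N_2$ finitely generated. $\mathcal{M}\Phi_{\pm}(H_{\mathcal{A}}) = \mathcal{M}\Phi_+(H_{\mathcal{A}}) \cup \mathcal{M}\Phi_-(H_{\mathcal{A}})$. For $F \in \mathcal{M}\Phi(H_{\mathcal{A}})$, take closed submodules $M_1, N_1, M_2, N_2$ of $H_{\mathcal{A}}$ with $H_{\mathcal{A}} = M_1 \tilde\oplus N_1 = M_2 \tilde\oplus N_2$, $F(M_1)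 \subseteq M_2$, $F(N_1) \subseteq N_2$, $F|_{M_1}: M_1 \to M_2$ an isomorphism, and $N_1, N_2$ finitely generated (such closed submodules are automatically projective). Then $\operatorname{index} F = [N_1] - [N_2] \in K(\mathcal{A})$, where $K(\mathcal{A}) = K_0(\mathcal{A})$ is the Grothendieck group of isomorphism classes of finitely generated projective modules; it is known (Mishchenko–Fomenko) that this does not depend on the chosen decomposition. *)

(* Defs.v *)
From HB Require Import structures.
From mathcomp Require Import all_boot all_order all_algebra.
From mathcomp Require Import complex.
From mathcomp Require Import all_classical all_reals all_analysis.

Set Implicit Arguments.
Unset Strict Implicit.
Unset Printing Implicit Defensive.

Import Order.TTheory GRing.Theory Num.Theory.
Import numFieldNormedType.Exports.

Local Open Scope classical_set_scope.
Local Open Scope ring_scope.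

(* Unital C*-algebras over R[i]: a complex Banach space with a unital
   submultiplicative product, a conjugate-linear involution and the
   C*-identity.  The zero algebra (one = 0) is not excluded. *)
Record cstarAlgType (R : realType) := CStarAlg {
  cstar_banach : completeNormedModType R[i];
  cstar_one : cstar_banach;
  cstar_mul : cstar_banach -> cstar_banach -> cstar_banach;
  cstar_star : cstar_banach -> cstar_banach;
  cstar_mulA : associative cstar_mul;
  cstar_mul1 : left_id cstar_one cstar_mul;
  cstar_mulr1 : right_id cstar_one cstar_mul;
  cstar_mulDl : left_distributive cstar_mul +%R;
  cstar_mulDr : right_distributive cstar_mul +%R;
  cstar_scaleAl : forall (k : R[i]) a b,
    cstar_mul (k *: a) b = k *: cstar_mul a b;
  cstar_scaleAr : forall (k : R[i]) a b,
    cstar_mul a (k *: b) = k *: cstar_mul a b;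
  cstar_norm_mul : forall a b, `|cstar_mul a b| <= `|a| * `|b|;
  cstar_starD : forall a b, cstar_star (a + b) = cstar_star a + cstar_star b;
  cstar_starZ : forall (k : R[i]) a, cstar_star (k *: a) = k^*%C *: cstar_star a;
  cstar_starM : forall a b,
    cstar_star (cstar_mul a b) = cstar_mul (cstar_star b) (cstar_star a);
  cstar_starK : involutive cstar_star;
  cstar_identity : forall a, `|cstar_mul (cstar_star a) a| = `|a| ^+ 2
}.

Definition cstar_sort (R : realType) (A : cstarAlgType R) : Type :=
  cstar_banach A.
Coercion cstar_sort : cstarAlgType >-> Sortclass.

HB.instance Definition _ (R : realType) (A : cstarAlgType R) :=
  CompleteNormedModule.on (cstar_sort A).
HB.instance Definition _ (R : realType) (A : cstarAlgType R) :=
  GRing.Zmodule_isPzRing.Build (cstar_sort A) (@cstar_mulA R A)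
    (@cstar_mul1 R A) (@cstar_mulr1 R A) (@cstar_mulDl R A) (@cstar_mulDr R A).

Definition star (R : realType) (A : cstarAlgType R) (a : A) : A :=
  @cstar_star R A a.

Section ProjectiveModules.
Variable S : pzRingType.

Definition finitely_generated (P : lmodType S) : Prop :=
  exists (n : nat) (e : 'I_n -> P),
    forall x : P, exists c : 'I_n -> S, x = \sum_(i < n) c i *: e i.

Definition projective (P : lmodType S) : Prop :=
  forall (M N : lmodType S) (g : M -> N) (h : P -> N),
    linear g -> linear h -> (forall y, exists x, g x = y) ->
  exists k : P -> M, linear k /\ forall x, g (k x) = h x.

Record fgprojType := FGProj {
  fgproj_sort :> lmodType S;
  fgproj_fg : finitely_generated fgproj_sort;
  fgproj_proj : projective fgproj_sort
}.

Definition mod_iso (P Q : lmodType S) : Prop :=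
  exists f : P -> Q, linear f /\ bijective f.

Lemma mod_iso_refl P : mod_iso P P.
Proof. by exists id; split=> //; exists id. Qed.

Lemma mod_iso_sym P Q : mod_iso P Q -> mod_iso Q P.
Proof.
move=> [f [lf [g fK gK]]]; exists g; split; last by exists f.
by move=> a u v; apply: (can_inj fK); rewrite gK lf !gK.
Qed.

Lemma mod_iso_trans P Q T : mod_iso P Q -> mod_iso Q T -> mod_iso P T.
Proof.
move=> [f [lf bf]] [g [lg bg]]; exists (g \o f); split; last exact: bij_comp.
by move=> a u v /=; rewrite lf lg.
Qed.

Lemma mod_iso_prod (P P' Q Q' : lmodType S) :
  mod_iso P P' -> mod_iso Q Q' -> mod_iso (P * Q)%type (P' * Q')%type.
Proof.
move=> [f [lf [f' fK f'K]]] [g [lg [g' gK g'K]]].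
exists (fun x => (f x.1, g x.2)); split.
  by move=> a [u1 u2] [v1 v2]; rewrite /= lf lg.
by exists (fun x => (f' x.1, g' x.2)) => -[x y] /=; rewrite ?fK ?gK ?f'K ?g'K.
Qed.

Lemma fg_prod (P Q : lmodType S) : finitely_generated P ->
  finitely_generated Q -> finitely_generated (P * Q)%type.
Proof.
move=> [n [e eP]] [m [d dQ]]; exists (n + m)%N.
exists (fun i => match fintype.split i with inl j => (e j, 0) | inr j => (0, d j) end).
move=> [x y]; have [c ->] := eP x; have [b ->] := dQ y.
exists (fun i => match fintype.split i with inl j => c j | inr j => b j end).
rewrite big_split_ord /=.
have sl (i : 'I_n) : fintype.split (lshift m i) = inl i.
  exact: (unsplitK (inl i)).
have sr (i : 'I_m) : fintype.split (rshift n i) = inr i.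
  exact: (unsplitK (inr i)).
rewrite [X in _ = X + _](eq_bigr (fun i => c i *: (e i, 0))); last first.
  by move=> i _; rewrite sl.
rewrite [X in _ = _ + X](eq_bigr (fun i => b i *: (0, d i))); last first.
  by move=> i _; rewrite sr.
rewrite [LHS]surjective_pairing [RHS]surjective_pairing /=.
rewrite !raddf_sum /=.
rewrite [X in _ = (_ + X, _)]big1 => [|i _]; last by rewrite scaler0.
rewrite [X in _ = (_, X + _)]big1 => [|i _]; last by rewrite scaler0.
by rewrite addr0 add0r.
Qed.

Lemma projective_prod (P Q : lmodType S) : projective P ->
  projective Q -> projective (P * Q)%type.
Proof.
move=> hP hQ M N g h lg lh sg.
have [|k [lk kP]] := hP M N g (fun x => h (x, 0)) lg _ sg.
  by move=> a u v; rewrite -lh; congr h; rewrite /= -[RHS]/(_, _) /= scaler0 addr0.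
have [|l [ll lP]] := hQ M N g (fun x => h (0, x)) lg _ sg.
  by move=> a u v; rewrite -lh; congr h; rewrite /= -[RHS]/(_, _) /= scaler0 addr0.
exists (fun x => k x.1 + l x.2); split.
  by move=> a [u1 u2] [v1 v2]; rewrite /= lk ll scalerDr addrACA.
move=> [x y] /=; have := lg 1 (k x) (l y); rewrite !scale1r => ->.
have := lh 1 (x, 0) (0, y); rewrite !scale1r kP lP => <-.
by congr h; rewrite -[LHS]/(_, _) /= addr0 add0r.
Qed.

Definition fgproj_sum (P Q : fgprojType) : fgprojType :=
  @FGProj (P * Q)%type (fg_prod (fgproj_fg P) (fgproj_fg Q))
    (projective_prod (@fgproj_proj P) (@fgproj_proj Q)).

Lemma fg_zero : finitely_generated 'rV[S]_0.
Proof.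
by exists 0, (fun=> 0) => x; exists (fun=> 0); rewrite big_ord0 thinmx0.
Qed.

Lemma projective_zero : projective 'rV[S]_0.
Proof.
move=> M N g h lg lh _; exists (fun=> 0); split.
  by move=> a u v; rewrite scaler0 addr0.
have l0 (X Y : lmodType S) (f : X -> Y) : linear f -> f 0 = 0.
  move=> /(_ 1 0 0); rewrite !scale1r addr0 => e.
  by apply: (addrI (f 0)); rewrite -e addr0.
by move=> x; rewrite thinmx0 !l0.
Qed.

Definition fgproj_zero : fgprojType := FGProj fg_zero projective_zero.

(* The Grothendieck group of the monoid, under direct sum, of isomorphism
   classes of finitely generated projective modules.  Its elements are the
   formal differences [P] - [Q], where [P] - [Q] = [P'] - [Q'] iff
   P + Q' + T and P' + Q + T are isomorphic for some T; each element is encoded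
   as the class of the pairs (P, Q) that it relates.  This type lives in a
   universe above that of [zmodType], so only its equality is set up. *)
Definition K0_rel (p q : fgprojType * fgprojType) : Prop :=
  exists T : fgprojType, mod_iso (fgproj_sum (fgproj_sum p.1 q.2) T)
                                 (fgproj_sum (fgproj_sum q.1 p.2) T).

Lemma K0_rel_refl p : K0_rel p p.
Proof. by exists fgproj_zero; exact: mod_iso_refl. Qed.

Lemma K0_rel_sym p q : K0_rel p q -> K0_rel q p.
Proof. by move=> [T e]; exists T; exact: mod_iso_sym. Qed.

Lemma K0_rel_trans p q r : K0_rel p q -> K0_rel q r -> K0_rel p r.
Proof.
case: p q r => [p1 p2] [q1 q2] [r1 r2] [T /= eT] [U /= eU].
exists (fgproj_sum (fgproj_sum q1 q2) (fgproj_sum T U)) => /=.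
apply: mod_iso_trans (mod_iso_trans (mod_iso_prod eT eU) _).
  exists (fun x => (x.1.1, x.2.1.2, x.2.2.1, (x.2.1.1, x.1.2, x.2.2.2))).
  split; first by [].
  exists (fun x => (x.1.1.1, x.2.1.2, (x.2.1.1, x.1.1.2, (x.1.2, x.2.2)))).
    by move=> [[? ?] [[? ?] [? ?]]].
  by move=> [[[? ?] ?] [[? ?] ?]].
exists (fun x => (x.2.1.1, x.1.1.2, (x.1.1.1, x.2.1.2, (x.1.2, x.2.2)))).
split; first by [].
exists (fun x => (x.2.1.1, x.1.2, x.2.2.1, (x.1.1, x.2.1.2, x.2.2.2))).
  by move=> [[[? ?] ?] [[? ?] ?]].
by move=> [[? ?] [[? ?] [? ?]]].
Qed.

Definition K0 := {C : fgprojType * fgprojType -> Prop | exists p, C = K0_rel p}.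

(* [P] - [Q] *)
Definition K0_diff (P Q : fgprojType) : K0 :=
  exist _ (K0_rel (P, Q)) (ex_intro _ (P, Q) erefl).

Lemma K0_diffP P Q P' Q' :
  K0_diff P Q = K0_diff P' Q' <-> K0_rel (P, Q) (P', Q').
Proof.
split=> [[e]|e]; first by rewrite e; exact: K0_rel_refl.
apply: eq_exist; apply/funext => p; apply/propext; split.
  exact: K0_rel_trans (K0_rel_sym e).
exact: K0_rel_trans e.
Qed.

End ProjectiveModules.

Section StandardModule.
Variables (R : realType) (A : cstarAlgType R).

Definition cseq := nat -> A.
HB.instance Definition _ := GRing.Zmodule.on cseq.

Implicit Types (x y : cseq) (M N : set cseq).

Definition rscale x (a : A) : cseq := fun i => x i * a.

Definition inner_partial x y : nat -> A :=
  fun n => \sum_(i < n) star (x i) * y i.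

(* H_A = l^2(A): the sequences x such that the series of the x_i^* x_i
   converges in the norm of A. *)
Definition HA : set cseq := [set x | cvgn (inner_partial x x)].

Definition inner x y : A := limn (inner_partial x y).

(* The norm of A takes values in R[i]; [complex.Re] reads it as a real. *)
Definition l2norm x : R := Num.sqrt (complex.Re `|inner x x|).

Definition l2_closed M : Prop :=
  forall x, HA x -> (forall e : R, 0 < e -> exists2 y, M y & l2norm (x - y) < e) ->
  M x.

Definition closed_submodule M : Prop :=
  [/\ M `<=` HA, M 0, forall x y, M x -> M y -> M (x + y),
      forall x (a : A), M x -> M (rscale x a) & l2_closed M].

Definition fin_gen M : Prop :=
  exists (n : nat) (e : 'I_n -> cseq),
    M = [set x | exists c : 'I_n -> A, x = \sum_(i < n) rscale (e i) (c i)].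

(* H_A is the direct, not necessarily orthogonal, sum of M and N. *)
Definition direct_sum M N : Prop :=
  HA = [set x | exists y z, [/\ M y, N z & x = y + z]] /\ M `&` N = [set 0].

Definition bounded_on (F : cseq -> cseq) : Prop :=
  exists c : R, forall x, HA x -> l2norm (F x) <= c * l2norm x.

Definition linear_on (F : cseq -> cseq) : Prop :=
  (forall x y, HA x -> HA y -> F (x + y) = F x + F y) /\
  (forall x (a : A), HA x -> F (rscale x a) = rscale (F x) a).

Definition adjointable_on (F : cseq -> cseq) : Prop :=
  exists G : cseq -> cseq, (forall x, HA x -> HA (G x)) /\
    forall x y, HA x -> HA y -> inner (F x) y = inner x (G y).

(* An element of B^a(H_A) is represented by the function that extends it by 0
   outside H_A, so that each operator has exactly one representative. *)
Record Ba := MkBa {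
  Ba_fun :> cseq -> cseq;
  Ba_HA : forall x, HA x -> HA (Ba_fun x);
  Ba_out : forall x, ~ HA x -> Ba_fun x = 0;
  Ba_linear : linear_on Ba_fun;
  Ba_bounded : bounded_on Ba_fun;
  Ba_adjointable : adjointable_on Ba_fun
}.

Definition opnorm (F : cseq -> cseq) : R :=
  sup [set l2norm (F x) | x in [set x | HA x /\ l2norm x <= 1]].

Definition norm_continuous_on (I : set R) (f : R -> Ba) : Prop :=
  forall t, I t ->
    opnorm (fun x => f s x - f t x) @[s --> within I (nbhs t)] --> (0 : R).

(* F maps M bijectively onto N with bounded inverse; linearity and boundedness
   of F itself are part of [Ba]. *)
Definition restricts_to_iso (F : Ba) M N : Prop :=
  set_bij M N F /\
  exists c : R, forall x, M x -> l2norm x <= c * l2norm (F x).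

Definition MPhi_decomposition (F : Ba) (M1 N1 M2 N2 : set cseq) : Prop :=
  [/\ [/\ closed_submodule M1, closed_submodule N1, closed_submodule M2
         & closed_submodule N2],
      direct_sum M1 N1, direct_sum M2 N2,
      F @` M1 `<=` M2 /\ F @` N1 `<=` N2 & restricts_to_iso F M1 M2].

Definition MPhi_plus : set Ba := [set F | exists M1 N1 M2 N2,
  MPhi_decomposition F M1 N1 M2 N2 /\ fin_gen N1].

Definition MPhi_minus : set Ba := [set F | exists M1 N1 M2 N2,
  MPhi_decomposition F M1 N1 M2 N2 /\ fin_gen N2].

Definition MPhi : set Ba := [set F | exists M1 N1 M2 N2,
  [/\ MPhi_decomposition F M1 N1 M2 N2, fin_gen N1 & fin_gen N2]].

Definition MPhi_pm : set Ba := MPhi_plus `|` MPhi_minus.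

(* The abstract module P is isomorphic to the submodule N of H_A. *)
Definition represents (P : lmodType A^c) N : Prop :=
  exists phi : P -> cseq,
    (forall (a : A) (p q : P), phi ((a : A^c) *: p + q) = rscale (phi p) a + phi q)
    /\ set_bij setT N phi.

(* Hilbert modules are right modules, i.e. left modules over the converse
   ring A^c. *)
Definition has_index (F : Ba) (k : K0 A^c) : Prop :=
  exists M1 N1 M2 N2 (P1 P2 : fgprojType A^c),
    [/\ MPhi_decomposition F M1 N1 M2 N2, fin_gen N1 /\ fin_gen N2,
        represents P1 N1, represents P2 N2
      & k = K0_diff P1 P2].

(* [N_1] - [N_2] for a chosen decomposition; it does not depend on the choice
   when F is in [MPhi], and is 0 when there is no such decomposition. *)
Definition fredholm_index (F : Ba) : K0 A^c :=
  if pselect (exists k, has_index F k) is left h then projT1 (cid h)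
  else K0_diff (fgproj_zero A^c) (fgproj_zero A^c).

End StandardModule.

Arguments HA {R A}.
Arguments MPhi_plus {R A}.
Arguments MPhi_minus {R A}.
Arguments MPhi {R A}.
Arguments MPhi_pm {R A}.

(* Main.v *)
From HB Require Import structures.
Require Import Defs.
From mathcomp Require Import all_boot all_order all_algebra.
From mathcomp Require Import complex.
From mathcomp Require Import all_classical all_reals all_analysis.
From mathcomp Require Import zify ring lra.
Import Order.TTheory GRing.Theory Num.Theory.
Import numFieldNormedType.Exports.
Set Implicit Arguments.
Unset Strict Implicit.
Unset Printing Implicit Defensive.
Local Open Scope classical_set_scope.
Local Open Scope ring_scope.

(** The three classes MPhi_plus minus MPhi, MPhi_minus minus MPhi and MPhi
    cover the path, and each of them is open for the operator norm, the third
    one with locally constant index.  Since [0, 1] is connected, the path stays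
    in the class of its origin, and its index does not change.

    The openness statements become algebra once a decomposition of F is traded
    for a bounded A-linear map G with G F G = G ([outer_inverse]): it has
    M1 = im G, N1 = ker (G F), M2 = im (F G) and N2 = ker G, and every such G
    arises from exactly one decomposition ([decomposition_outer],
    [outer_decomposition]).  If F' is close to F, then U = 1 + G (F' - F) is
    invertible by a Neumann series and U^-1 G is an outer inverse of F'; its
    N2 is ker G again, and its N1 is the image under U^-1 of ker (G F)
    ([outer_perturb]).  So the isomorphism classes of N1 and N2 persist.

    What remains is that two outer inverses G, G' of the same F compare.
    Modulo maps with finitely generated image, a finitely generated N1 makes G
    a left inverse of F, and a finitely generated N2' makes G' a right inverse;
    so both are two-sided, and all four modules N1, N2, N1', N2' are finitely
    generated ([semi_fredholm_both]).  This gives that MPhi is the intersection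
    of MPhi_plus and MPhi_minus, and that a small perturbation of
    a semi-Fredholm operator
    outside MPhi stays outside MPhi.  If all four modules are finitely
    generated, then F completes to invertible matrices
    H + N2 -> H + N1 and H + N2' -> H + N1', and the quotient of the two has
    a corner 1 - b a with a : H -> N2 + N1' and b : N2 + N1' -> H; a Schur
    complement turns this into a stable isomorphism of N1 + N2' with
    N1' + N2 ([index_invariance]).

    The analysis needed is the following.  The C*-identity alone yields enough
    of the order structure of A, without spectral theory, to obtain the
    Cauchy-Schwarz inequality on finite sums and hence to see that H_A is
    a complete normed module ([pos_starM], [ip_CS], [hmod_complete]).
    A Baire category argument ([zabreiko]) shows that the projections of
    a closed direct sum are bounded ([bdd_projection]) and that coefficients
    along finitely many generators can be chosen small ([fg_open]).  The latter
    is used to move the generators of a complemented submodule into A^m,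
    which gives it a finite dual basis ([dual_basis]); this is why the modules
    N1 and N2 of a Fredholm operator are projective and define classes in
    K0. *)

(** * Identities in abelian groups and linear maps *)

(** Formal expressions of an abelian group, so that identities between sums
    and differences are decided by comparing integer coefficients; rings such
    as A need not be commutative, and modules have no product at all. *)
Inductive zexp := ZVar of nat | ZAdd of zexp & zexp | ZOpp of zexp | ZZero.

Fixpoint zeval (V : zmodType) (env : seq V) (e : zexp) : V :=
  match e with
  | ZVar n => nth 0 env n
  | ZAdd e1 e2 => zeval env e1 + zeval env e2
  | ZOpp e1 => - zeval env e1
  | ZZero => 0
  end.

Fixpoint zcoef (e : zexp) (i : nat) : int :=
  match e with
  | ZVar n => (i == n)%:R
  | ZAdd e1 e2 => zcoef e1 i + zcoef e2 i
  | ZOpp e1 => - zcoef e1 i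
  | ZZero => 0
  end.

Lemma zevalE (V : zmodType) (env : seq V) e :
  zeval env e = \sum_(i < size env) env`_i *~ zcoef e i.
Proof.
elim: e => /= [n|e1 -> e2 ->|e1 ->|]; last by rewrite big1.
- have [nl|nl] := ltnP n (size env); last first.
    rewrite nth_default // big1 // => i _.
    by rewrite ltn_eqF ?mulr0z // (leq_trans (ltn_ord i)).
  rewrite (bigD1 (Ordinal nl)) //= eqxx mulr1z big1 ?addr0 // => i.
  by rewrite -val_eqE /= => /negPf ->.
- by rewrite -big_split; apply: eq_bigr => i _; rewrite mulrzDr.
- by rewrite -sumrN; apply: eq_bigr => i _; rewrite mulrNz.
Qed.

Lemma zeval_eq (V : zmodType) (env : seq V) (e1 e2 : zexp) :
  all (fun i => zcoef e1 i == zcoef e2 i) (iota 0 (size env)) ->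
  zeval env e1 = zeval env e2.
Proof.
move=> /allP h; rewrite !zevalE; apply: eq_bigr => i _; congr (_ *~ _).
by apply/eqP/h; rewrite mem_iota /=.
Qed.

Ltac zfind x env :=
  lazymatch env with
  | ?y :: ?env' =>
    match constr:(tt) with
    | _ => let _ := match constr:(tt) with _ => unify x y end in constr:(0%N)
    | _ => let n := zfind x env' in constr:(S n)
    end
  end.
Ltac zreify env t :=
  lazymatch t with
  | (?a + ?b)%R => let ea := zreify env a in let eb := zreify env b in
                 constr:(ZAdd ea eb)
  | (- ?a)%R => let ea := zreify env a in constr:(ZOpp ea)
  | 0%R => constr:(ZZero)
  | _ => let n := zfind t env in constr:(ZVar n)
  end.
Ltac zinsert x env :=
  lazymatch env with
  | nil => constr:(x :: nil)
  | ?y :: ?env' =>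
    match constr:(tt) with
    | _ => let _ := match constr:(tt) with _ => unify x y end in env
    | _ => let e := zinsert x env' in constr:(y :: e)
    end
  end.
Ltac zatoms env t :=
  lazymatch t with
  | (?a + ?b)%R => let e := zatoms env a in zatoms e b
  | (- ?a)%R => zatoms env a
  | 0%R => env
  | _ => zinsert t env
  end.
Ltac zmodule :=
  lazymatch goal with
  | |- @eq ?V ?a ?b =>
    let env := zatoms (@nil V) a in
    let env := zatoms env b in
    let ea := zreify env a in
    let eb := zreify env b in
    refine (@zeval_eq _ env ea eb _); vm_compute; reflexivity
  end.

Section Linear.
Variables (S : pzRingType) (U V : lmodType S) (T : U -> V).
Hypothesis lT : linear T.

Lemma linD : {morph T : x y / x + y}.
Proof. by move=> x y; have := lT 1 x y; rewrite !scale1r. Qed.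

Lemma lin0 : T 0 = 0.
Proof. by apply: (addrI (T 0)); rewrite -linD !addr0. Qed.

Lemma linN : {morph T : x / - x}.
Proof. by move=> x; apply: (addrI (T x)); rewrite -linD !subrr lin0. Qed.

Lemma linB : {morph T : x y / x - y}.
Proof. by move=> x y; rewrite linD linN. Qed.

Lemma linZ a : {morph T : x / a *: x}.
Proof. by move=> x; have := lT a x 0; rewrite lin0 !addr0. Qed.

Lemma lin_sum I (r : seq I) (P : pred I) (F : I -> U) :
  T (\sum_(i <- r | P i) F i) = \sum_(i <- r | P i) T (F i).
Proof. exact: (big_morph _ linD lin0). Qed.

End Linear.

(** * Outer inverses and the index *)

Section FiniteRank.
Variables (S : pzRingType) (H : lmodType S).
Implicit Types (T F G Q : H -> H).

Definition finite_rank T := exists n (e : 'I_n -> H),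
  forall x, exists c : 'I_n -> S, T x = \sum_(i < n) c i *: e i.

Definition fg_pred (P : H -> Prop) := exists n (e : 'I_n -> H),
  forall x, P x <-> exists c : 'I_n -> S, x = \sum_(i < n) c i *: e i.

Lemma finite_rankD T Q : finite_rank T -> finite_rank Q ->
  finite_rank (fun x => T x + Q x).
Proof.
move=> [n [e Te]] [m [d Qd]]; exists (n + m)%N.
exists (fun i => match fintype.split i with inl j => e j | inr j => d j end).
move=> x; have [c ->] := Te x; have [b ->] := Qd x.
exists (fun i => match fintype.split i with inl j => c j | inr j => b j end).
rewrite big_split_ord /=; congr (_ + _); apply: eq_bigr => i _.
  by have -> : fintype.split (lshift m i) = inl i by exact: (unsplitK (inl i)).
by have -> : fintype.split (rshift n i) = inr i by exact: (unsplitK (inr i)).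
Qed.

Lemma finite_rankl L T : linear L -> finite_rank T ->
  finite_rank (fun x => L (T x)).
Proof.
move=> lL [n [e Te]]; exists n, (fun i => L (e i)) => x.
have [c ->] := Te x; exists c; rewrite (lin_sum lL).
by apply: eq_bigr => i _; rewrite (linZ lL).
Qed.

Lemma finite_rankr T L : finite_rank T -> finite_rank (fun x => T (L x)).
Proof. by move=> [n [e Te]]; exists n, e => x; exact: Te. Qed.

Lemma finite_rankN T : finite_rank T -> finite_rank (fun x => - T x).
Proof.
by apply: finite_rankl => a x y; rewrite opprD scalerN.
Qed.

(** Pushing the spanning family through Q brings it into the image of Q. *)
Lemma fg_fixP Q : linear Q -> (forall x, Q (Q x) = Q x) ->
  fg_pred (fun x => Q x = x) <-> finite_rank Q.
Proof.
move=> lQ QQ; split=> [[n [e He]]|[n [e He]]].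
  by exists n, e => x; apply/He.
exists n, (fun i => Q (e i)) => x; split=> [Qx|[c ->]].
  have [c ce] := He x; exists c; rewrite -{1}Qx -QQ ce (lin_sum lQ).
  by apply: eq_bigr => i _; rewrite (linZ lQ).
rewrite (lin_sum lQ); apply: eq_bigr => i _.
by rewrite (linZ lQ) QQ.
Qed.

Lemma fg_pred_eq (P P' : H -> Prop) : (forall x, P x <-> P' x) ->
  fg_pred P -> fg_pred P'.
Proof. by move=> PP [n [e He]]; exists n, e => x; rewrite -PP. Qed.

Lemma fg_pred_iso (P : H -> Prop) U V : linear V -> cancel U V -> cancel V U ->
  fg_pred P -> fg_pred (fun x => P (U x)).
Proof.
move=> lV UV VU [n [e He]]; exists n, (fun i => V (e i)) => x; rewrite He.
have E (c : 'I_n -> S) : \sum_(i < n) c i *: V (e i) = V (\sum_(i < n) c i *: e i).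
  by rewrite (lin_sum lV); apply: eq_bigr => i _; rewrite (linZ lV).
split=> [[c ce]|[c ->]]; first by exists c; rewrite E -ce UV.
by exists c; rewrite E VU.
Qed.

End FiniteRank.

Section OuterInverse.
Variables (S : pzRingType) (H : lmodType S).
Implicit Types (F G : H -> H).

(** G encodes the splitting of F with M1 = im G, N1 = ker (G F),
    M2 = im (F G) and N2 = ker G. *)
Definition outer_inverse F G := linear G /\ forall y, G (F (G y)) = G y.

Lemma outer_ker1 F G x : (G (F x) = 0) <-> (x - G (F x) = x).
Proof.
split=> [->|e]; first by rewrite subr0.
by rewrite -[LHS](subKr x) e subrr.
Qed.

Lemma outer_ker2 F G y : linear F -> outer_inverse F G -> (G y = 0) <-> (y - F (G y) = y).
Proof.
move=> lF [lG GFG]; split=> [->|e]; first by rewrite (lin0 lF) subr0.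
by rewrite -GFG -[F _](subKr y) e subrr (lin0 lG).
Qed.

Lemma outer_idem1 F G x : linear F -> outer_inverse F G ->
  let Q x := x - G (F x) in Q (Q x) = Q x.
Proof.
move=> lF [lG GFG] /=; rewrite (linB lF) (linB lG) GFG; zmodule.
Qed.

Lemma outer_idem2 F G y : linear F -> outer_inverse F G ->
  let Q y := y - F (G y) in Q (Q y) = Q y.
Proof.
move=> lF [lG GFG] /=; rewrite (linB lG) GFG subrr (lin0 lF); zmodule.
Qed.

Lemma comp_lin F G : linear F -> linear G -> linear (fun x => G (F x)).
Proof. by move=> lF lG a x y; rewrite lF lG. Qed.

Lemma compl_lin F : linear F -> linear (fun x => x - F x).
Proof. by move=> lF a x y; rewrite lF scalerBr; zmodule. Qed.

Lemma fg_ker1 F G : linear F -> outer_inverse F G ->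
  fg_pred (fun x => G (F x) = 0) <-> finite_rank (fun x => x - G (F x)).
Proof.
move=> lF oG; have lG := oG.1.
have <- := fg_fixP (compl_lin (comp_lin lF lG)) (fun x => @outer_idem1 F G x lF oG).
by split; apply: fg_pred_eq => x; [|apply: iff_sym]; exact (@outer_ker1 F G x).
Qed.

Lemma fg_ker2 F G : linear F -> outer_inverse F G ->
  fg_pred (fun y => G y = 0) <-> finite_rank (fun y => y - F (G y)).
Proof.
move=> lF oG; have lG := oG.1.
have <- := fg_fixP (compl_lin (comp_lin lG lF)) (fun x => @outer_idem2 F G x lF oG).
by split; apply: fg_pred_eq => x; [|apply: iff_sym]; exact (@outer_ker2 F G x lF oG).
Qed.

(** Modulo maps of finite rank the hypotheses read G F = 1 and F G' = 1,
    whence G = G F G' = G', so that G and G' are both two-sided inverses. *)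
Theorem semi_fredholm_both F G G' : linear F -> outer_inverse F G -> outer_inverse F G' ->
  fg_pred (fun x => G (F x) = 0) -> fg_pred (fun y => G' y = 0) ->
  fg_pred (fun y => G y = 0) /\ fg_pred (fun x => G' (F x) = 0).
Proof.
move=> lF oG oG' /(fg_ker1 lF oG) f1 /(fg_ker2 lF oG') f2.
have [[lG GFG] [lG' GFG']] := (oG, oG').
split.
  apply/(fg_ker2 lF oG); have -> : (fun y => y - F (G y)) = (fun y =>
    (y - F (G' y)) + F (G' y - G (F (G' y))) - F (G (y - F (G' y)))).
    by apply/funext => y; rewrite !(linB lG, linB lF); zmodule.
  apply: finite_rankD.
    by apply: finite_rankD => //; apply: finite_rankl => //; exact: finite_rankr f1.
  apply: finite_rankN; apply: (@finite_rankl _ _ (fun y => F (G y)) _ _ f2).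
  exact: comp_lin.
apply/(fg_ker1 lF oG'); have -> : (fun x => x - G' (F x)) = (fun x =>
  (x - G (F x)) + G (F x - F (G' (F x))) - (G' (F x) - G (F (G' (F x))))).
  by apply/funext => y; rewrite !(linB lG, linB lF); zmodule.
apply: finite_rankD; last first.
  exact: finite_rankN (finite_rankr (fun x => G' (F x)) f1).
by apply: finite_rankD => //; apply: finite_rankl => //; exact: finite_rankr f2.
Qed.

(** As G F' = U - (1 - G F) and (1 - G F) V G = 0, the map V G satisfies
    (V G) F' (V G) = V G when V inverts U; and G F U = G F'. *)
Theorem outer_perturb F F' G V : linear F -> linear F' -> outer_inverse F G -> linear V ->
  let U x := x + G (F' x - F x) in cancel U V -> cancel V U ->
  [/\ outer_inverse F' (fun y => V (G y)),
     forall y, V (G y) = 0 <-> G y = 0 &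
     forall x, V (G (F' x)) = 0 <-> G (F (U x)) = 0].
Proof.
move=> lF lF' [lG GFG] lV U UV VU.
have GU x : G (F (U x)) = G (F' x).
  by rewrite /U (linD lF) (linD lG) GFG (linB lG); zmodule.
have V0 y : V y = 0 <-> y = 0.
  split=> [e|->]; last exact: lin0.
  by rewrite -(VU y) e /U !(lin0 lF, lin0 lF', lin0 lG, subr0, addr0).
split=> //; last by move=> x; rewrite V0 GU.
split; first by move=> a x y; rewrite lG lV.
by move=> y; rewrite -GU VU GFG.
Qed.

End OuterInverse.

Section Index.
Variables (S : pzRingType).

(** The isomorphism is the Schur complement of the corner H -> H of Z, which
    is the identity: x is sent to the Y-component of Z at the only point
    (h, x) where the H-component of Z vanishes. *)
Lemma schur_iso (H X Y : lmodType S) (Z : (H * X)%type -> (H * Y)%type)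
    (Z' : (H * Y)%type -> (H * X)%type) :
  linear Z -> cancel Z Z' -> cancel Z' Z ->
  (forall h, (Z (h, 0)).1 = h) -> mod_iso X Y.
Proof.
move=> lZ ZK Z'K Z1.
have ZD h x : Z (h, x) = Z (h, 0) + Z (0, x).
  rewrite -(linD lZ); congr Z; rewrite -[RHS]/(_, _) /=.
  by congr pair; rewrite ?addr0 ?add0r.
pose b x := (Z (0, x)).1.
have zero x : (Z (- b x, x)).1 = 0.
  by rewrite ZD -[LHS]/((Z (- b x, 0)).1 + b x) Z1 addNr.
exists (fun x => (Z (- b x, x)).2); split.
  move=> a x y.
  have bL : b (a *: x + y) = a *: b x + b y.
    rewrite /b -[RHS]/((a *: Z (0, x) + Z (0, y)).1) -lZ; congr (Z _).1.
    by rewrite -[RHS]/(_, _) /= scaler0 addr0.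
  rewrite -[RHS]/((a *: Z (- b x, x) + Z (- b y, y)).2) -lZ; congr (Z _).2.
  by rewrite -[RHS]/(_, _) /= bL opprD scalerN.
exists (fun y => (Z' (0, y)).2) => [x|y].
  have -> : (0, (Z (- b x, x)).2) = Z (- b x, x).
    by rewrite -[X in (X, _) = _](zero x) -surjective_pairing.
  by rewrite ZK.
case e : (Z' (0, y)) => [h x] /=.
have Zhx : Z (h, x) = (0, y) by rewrite -e Z'K.
have -> : - b x = h.
  apply/eqP; rewrite eq_sym -addr_eq0; apply/eqP.
  by rewrite -[RHS]/((0 : H, y).1) -Zhx ZD -[RHS]/((Z (h, 0)).1 + b x) Z1.
by rewrite Zhx.
Qed.

Section IndexInvariance.
Variables (H P1 P2 P1' P2' : lmodType S) (F G G' : H -> H).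
Variables (i1 : P1 -> H) (q1 : H -> P1) (i2 : P2 -> H) (q2 : H -> P2).
Variables (i1' : P1' -> H) (q1' : H -> P1') (i2' : P2' -> H) (q2' : H -> P2').

(** P is the image of the idempotent Q, with inclusion i and projection q. *)
Definition splits (P : lmodType S) (i : P -> H) (q : H -> P) (Q : H -> H) :=
  [/\ linear i, linear q, forall p, q (i p) = p & forall x, i (q x) = Q x].

(** The maps (x, n) |-> (F G0 F x + j n, q x) and (y, m) |-> (G0 y + i m, p y)
    between H + coker and H + ker are inverse to each other; the four equations
    are the components of the two composites. *)
Lemma fredholm_matrixK (G0 : H -> H) (P Q : lmodType S) (i : P -> H) q (j : Q -> H) p :
  linear F -> outer_inverse F G0 ->
  splits i q (fun x => x - G0 (F x)) -> splits j p (fun y => y - F (G0 y)) ->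
  (forall y m, F (G0 (F (G0 y + i m))) + j (p y) = y) *
  (forall y m, q (G0 y + i m) = m) *
  (forall x n, G0 (F (G0 (F x)) + j n) + i (q x) = x) *
  (forall x n, p (F (G0 (F x)) + j n) = n).
Proof.
move=> lF [lG GFG] [li lq qi iq] [lj lp pj jp].
have qG y : q (G0 y) = 0 by rewrite -[LHS]qi iq GFG subrr (lin0 lq).
have GFi m : G0 (F (i m)) = 0.
  by apply (@outer_ker1 _ _ F G0 (i m)).2; rewrite -iq qi.
have FGj n : F (G0 (j n)) = 0 by rewrite -[LHS](subKr (j n)) -jp pj subrr.
have Gj n : G0 (j n) = 0 by rewrite -GFG FGj (lin0 lG).
have pFG y : p (F (G0 y)) = 0 by rewrite -[LHS]pj jp GFG subrr (lin0 lp).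
split; [split; [split|]|].
- by move=> y m; rewrite (linD lF) (linD lG) GFi addr0 GFG jp addrC subrK.
- by move=> y m; rewrite (linD lq) qG add0r qi.
- by move=> x n; rewrite (linD lG) Gj addr0 GFG iq addrC subrK.
- by move=> x n; rewrite (linD lp) pFG add0r pj.
Qed.

(** Going from H + P1 to H + P2 by the matrix of G, and from H + P2' to
    H + P1' by the matrix of G', gives an isomorphism from H + P1 + P2' to
    H + P1' + P2 with corner F G' F G = 1 - (i2 q2 + F i1' q1' G).  The defect
    factors through P2 + P1'; adding that module as a further summand, two
    elementary operations restore the corner 1 needed for [schur_iso]. *)
Theorem index_invariance : linear F -> outer_inverse F G -> outer_inverse F G' ->
  splits i1 q1 (fun x => x - G (F x)) -> splits i2 q2 (fun y => y - F (G y)) ->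
  splits i1' q1' (fun x => x - G' (F x)) -> splits i2' q2' (fun y => y - F (G' y)) ->
  mod_iso (P1 * P2' * (P2 * P1'))%type (P1' * P2 * (P2 * P1'))%type.
Proof.
move=> lF oG oG' s1 s2 s1' s2'.
have [[[K1 K2] K3] K4] := fredholm_matrixK lF oG s1 s2.
have [[[K1' K2'] K3'] K4'] := fredholm_matrixK lF oG' s1' s2'.
have [[lG GFG] [lG' GFG']] := (oG, oG').
have [li1 lq1 qi1 iq1] := s1; have [li2 lq2 qi2 iq2] := s2.
have [li1' lq1' qi1' iq1'] := s1'; have [li2' lq2' qi2' iq2'] := s2'.
(* (y, m) is sent to (x, n) by the inverse matrix of G, and (x, n') to the pair
   of the H-component and m' by the matrix of G'; u1, v1 and the terms they
   contribute are the two elementary operations. *)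
pose Z (w : (H * (P1 * P2' * (P2 * P1')))%type) : (H * (P1' * P2 * (P2 * P1')))%type :=
  let: (y, (m, n', (u, v))) := w in
  let x := G y + i1 m in let u1 := u + q2 y in let v1 := v + q1' (G y) in
  (F (G' (F x)) + i2' n' + (i2 u1 + F (i1' v1)), (q1' x, q2 y, (u1, v1))).
pose Z' (w : (H * (P1' * P2 * (P2 * P1')))%type) : (H * (P1 * P2' * (P2 * P1')))%type :=
  let: (z1, (m', n, (u1, v1))) := w in
  let z := z1 - (i2 u1 + F (i1' v1)) in
  let x := G' z + i1' m' in let y := F (G (F x)) + i2 n in
  (y, (q1 x, q2' z, (u1 - q2 y, v1 - q1' (G y)))).
apply: (@schur_iso H _ _ Z Z').
- move=> a [y [[m n'] [u v]]] [y' [[m' n''] [u' v']]]; rewrite /Z.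
  rewrite -[LHS]/(Z (a *: y + y', (a *: m + m', a *: n' + n'', (a *: u + u', a *: v + v')))) /Z.
  rewrite -[RHS]/(_ , ((_ , _), (_, _))) /=.

  rewrite !(linD lF, linD lG, linD lG', linD li1, linD li2, linD li1',
    linD li2', linD lq1, linD lq2, linD lq1', linD lq2').
  rewrite !(linZ lF, linZ lG, linZ lG', linZ li1, linZ li2, linZ li1',
    linZ li2', linZ lq1, linZ lq2, linZ lq1', linZ lq2', scalerDr).
  by congr (_, (_, _, (_, _))); zmodule.
- move=> [y [[m n'] [u v]]]; rewrite /Z /Z' addrK K3' K4' K1.
  by rewrite K2 !addrK.
- move=> [z1 [[m' n] [u1 v1]]]; rewrite /Z /Z' K3 K4 !subrK K1'.
  by rewrite K2' subrK.
- move=> h; rewrite /Z /=.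
  rewrite (lin0 li1) (lin0 li2') !add0r !addr0 iq2 iq1'.
  rewrite !(linB lF); zmodule.
Qed.

End IndexInvariance.
End Index.

(** * Norm and limits in a C*-algebra *)

Section RealNorm.
Context {R : realType} {A : cstarAlgType R}.
Implicit Types (a b c : A) (t : R).

(** The norm of A takes nonnegative values in the complex field over R; all
    estimates below are done on its real part. *)
Definition nrm (a : A) : R := complex.Re `|a|.

Definition rsc (t : R) (a : A) : A := (real_complex R t) *: a.

Lemma nrmE a : (real_complex R (nrm a)) = `|a|.
Proof. by apply: RRe_real; exact: normr_real. Qed.

Lemma nrm_ge0 a : 0 <= nrm a.
Proof. by rewrite -ler0c nrmE. Qed.

Lemma nrm0 : nrm 0 = 0.
Proof. by rewrite /nrm normr0. Qed.

Lemma nrm0_eq0 a : nrm a <= 0 -> a = 0.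
Proof.
move=> a0; apply/eqP; rewrite -normr_eq0 -nrmE.
by have /eqP -> : nrm a == 0 by rewrite eq_le a0 nrm_ge0.
Qed.

Lemma nrmN a : nrm (- a) = nrm a.
Proof. by rewrite /nrm normrN. Qed.

Lemma nrmD a b : nrm (a + b) <= nrm a + nrm b.
Proof. by rewrite -lecR rmorphD /= !nrmE ler_normD. Qed.

Lemma nrmB a b : nrm (a - b) <= nrm a + nrm b.
Proof. by rewrite -(nrmN b) nrmD. Qed.

Lemma nrm_distC a b : nrm (a - b) = nrm (b - a).
Proof. by rewrite -nrmN opprB. Qed.

Lemma nrmM a b : nrm (a * b) <= nrm a * nrm b.
Proof. rewrite -lecR rmorphM /= !nrmE; exact: cstar_norm_mul. Qed.

Lemma nrm_rsc t a : nrm (rsc t a) = `|t| * nrm a.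
Proof.
apply: (@complexI R); rewrite rmorphM /= !nrmE /rsc normrZ; congr (_ * _).
by rewrite normc_def /= expr0n addr0 sqrtr_sqr.
Qed.

Lemma rscDr t a b : rsc t (a + b) = rsc t a + rsc t b.
Proof. exact: scalerDr. Qed.

Lemma rscDl s t a : rsc (s + t) a = rsc s a + rsc t a.
Proof. by rewrite /rsc rmorphD scalerDl. Qed.

Lemma rscBr t a b : rsc t (a - b) = rsc t a - rsc t b.
Proof. exact: scalerBr. Qed.

Lemma rscA s t a : rsc s (rsc t a) = rsc (s * t) a.
Proof. by rewrite /rsc rmorphM scalerA. Qed.

Lemma rsc1 a : rsc 1 a = a.
Proof. by rewrite /rsc rmorph1 scale1r. Qed.

Lemma rscAl t a b : rsc t a * b = rsc t (a * b).
Proof. exact: cstar_scaleAl. Qed.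

Lemma rscAr t a b : a * rsc t b = rsc t (a * b).
Proof. exact: cstar_scaleAr. Qed.

Lemma starD a b : star (a + b) = star a + star b.
Proof. exact: cstar_starD. Qed.

Lemma star0 : star (0 : A) = 0.
Proof. by apply: (addrI (star 0)); rewrite -starD !addr0. Qed.

Lemma starN a : star (- a) = - star a.
Proof. by apply: (addrI (star a)); rewrite -starD !subrr star0. Qed.

Lemma starB a b : star (a - b) = star a - star b.
Proof. by rewrite starD starN. Qed.

Lemma starM a b : star (a * b) = star b * star a.
Proof. exact: cstar_starM. Qed.

Lemma starK a : star (star a) = a.
Proof. exact: cstar_starK. Qed.

Lemma star_rsc t a : star (rsc t a) = rsc t (star a).
Proof. by rewrite /star /rsc cstar_starZ /= oppr0. Qed.

Lemma star1 : star (1 : A) = 1.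
Proof. by rewrite -[LHS]mulr1 -{2}[1]starK -starM mulr1 starK. Qed.

Lemma star_sum I (r : seq I) (P : pred I) (F : I -> A) :
  star (\sum_(i <- r | P i) F i) = \sum_(i <- r | P i) star (F i).
Proof. by apply: (big_morph _ starD star0). Qed.

Lemma nrm_starM a : nrm (star a * a) = nrm a ^+ 2.
Proof.
apply: (@complexI R); rewrite rmorphXn /= !nrmE; exact: cstar_identity.
Qed.

Lemma nrm_star a : nrm (star a) = nrm a.
Proof.
suff le b : nrm b <= nrm (star b) by apply/eqP; rewrite eq_le -{2}(starK a) !le.
have [->|b0] := eqVneq (nrm b) 0; first exact: nrm_ge0.
have bp : 0 < nrm b by rewrite lt_neqAle eq_sym b0 nrm_ge0.
by rewrite -(ler_pM2r bp) -expr2 -nrm_starM nrmM.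
Qed.

Lemma nrm_sa_sq a : star a = a -> nrm (a * a) = nrm a ^+ 2.
Proof. by move=> sa; rewrite -nrm_starM sa. Qed.

Lemma nrm1_le : nrm (1 : A) <= 1.
Proof.
have := nrm_starM (1 : A); rewrite star1 mulr1 => e.
have := nrm_ge0 (1 : A); nra.
Qed.

Lemma nrm_rsc1 t : 0 <= t -> nrm (rsc t 1) <= t.
Proof.
by move=> t0; rewrite nrm_rsc ger0_norm // ler_piMr // nrm1_le.
Qed.

(** Convergence with real tolerances in place of the complex ones of the
    topology of A. *)
Definition tends (u : nat -> A) (l : A) :=
  forall e : R, 0 < e -> exists N, forall n, (N <= n)%N -> nrm (u n - l) < e.

Lemma tends_cvg (u : nat -> A) (l : A) : tends u l <-> (u @ \oo --> l).
Proof.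
split.
  move=> ul; apply/cvgrPdist_lt => e e0.
  have e0' : 0 < complex.Re e by move: e0; rewrite ltcE => /andP[].
  have [N HN] := ul _ e0'; exists N => // n /= /HN h.
  rewrite distrC -nrmE.
  have -> : e = (real_complex R (complex.Re e)).
    by rewrite RRe_real // ger0_real // ltW.
  by rewrite ltcR.
move=> /cvgrPdist_lt ul e e0.
have /ul [N _ HN] : 0 < (real_complex R e) by rewrite ltcR.
exists N => n /HN /=; by rewrite distrC -nrmE ltcR.
Qed.

Definition cauchy_nrm (u : nat -> A) :=
  forall e : R, 0 < e -> exists N, forall m n, (N <= m)%N -> (m <= n)%N ->
    nrm (u n - u m) < e.

Lemma cauchy_tends (u : nat -> A) : cauchy_nrm u -> exists l, tends u l.
Proof.
move=> cu.
suff : cvgn u by move=> /cvg_ex[l /tends_cvg ?]; exists l.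
apply/cauchy_cvgP/cauchy_ballP => e e0.
have e0' : 0 < complex.Re e by move: e0; rewrite ltcE => /andP[].
have [N HN] := cu _ e0'.
have sp : forall m n, (N <= m)%N -> (N <= n)%N -> ball (u m) e (u n).
  move=> m n Nm Nn; rewrite -ball_normE /ball_ /=  -nrmE.
  have -> : e = (real_complex R (complex.Re e)).
    by rewrite RRe_real // ger0_real // ltW.
  rewrite ltcR; have [/HN|/ltnW/HN] := leqP m n; last exact.
  by rewrite nrm_distC => ->.
pose B := [set u m | m in [set m | (N <= m)%N]].
exists (B, B) => /=; first by split; exists N => // m Nm; exists m.
by move=> [_ _] /= [[m Nm <-] [n Nn <-]]; exact: sp.
Qed.

End RealNorm.

Section Limits.
Context {R : realType} {A : cstarAlgType R}.
Implicit Types (a b c l : A) (u v : nat -> A).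

Lemma nrm_small0 a : (forall e : R, 0 < e -> nrm a <= e) -> a = 0.
Proof. by move=> h; apply: nrm0_eq0; apply/ler_addgt0Pr => e /h; rewrite add0r. Qed.

Lemma tends_lip u l (f : A -> A) (C : R) :
  (forall a b, nrm (f a - f b) <= C * nrm (a - b)) ->
  tends u l -> tends (f \o u) (f l).
Proof.
move=> lip ul e e0.
have C1 : 0 < `|C| + 1 by rewrite ltr_wpDl.
have [N HN] := ul _ (divr_gt0 e0 C1); exists N => n /HN /= h.
rewrite (le_lt_trans (lip _ _)) //.
apply: (@le_lt_trans _ _ ((`|C| + 1) * nrm (u n - l))).
  by rewrite ler_wpM2r ?nrm_ge0 // (le_trans (ler_norm _)) // lerDl.
by rewrite mulrC -ltr_pdivlMr.
Qed.

Lemma tendsD u v l m : tends u l -> tends v m -> tends (fun n => u n + v n) (l + m).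
Proof.
move=> ul vm e e0; have e2 : 0 < e / 2 by rewrite divr_gt0.
have [N1 H1] := ul _ e2; have [N2 H2] := vm _ e2.
exists (maxn N1 N2) => n; rewrite geq_max => /andP[/H1 h1 /H2 h2].
rewrite opprD addrACA (le_lt_trans (nrmD _ _)) //; lra.
Qed.

Lemma tends_uniq u l m : tends u l -> tends u m -> l = m.
Proof.
move=> ul um; apply/eqP; rewrite -subr_eq0; apply/eqP/nrm_small0 => e e0.
have e2 : 0 < e / 2 by rewrite divr_gt0.
have [N1 H1] := ul _ e2; have [N2 H2] := um _ e2.
have h1 := H1 _ (leq_maxl N1 N2); have h2 := H2 _ (leq_maxr N1 N2).
set n := maxn _ _ in h1 h2.
have -> : l - m = (u n - m) - (u n - l) by rewrite opprB [RHS]addrC subrKA.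
rewrite (le_trans (nrmB _ _)) //; lra.
Qed.

Lemma tends_nrm_le u l (c : R) : tends u l ->
  (exists N, forall n, (N <= n)%N -> nrm (u n) <= c) -> nrm l <= c.
Proof.
move=> ul [M uc]; apply/ler_addgt0Pr => e e0; have [N HN] := ul _ e0.
have h := HN _ (leq_maxr M N); have := uc _ (leq_maxl M N).
set n := maxn _ _ in h * => h2.
have -> : l = u n - (u n - l) by rewrite opprB addrC subrK.
rewrite (le_trans (nrmB _ _)) //; lra.
Qed.

Lemma tends_nrm_bounded u l : tends u l ->
  exists2 C : R, 0 < C & exists N, forall n, (N <= n)%N -> nrm (u n) <= C.
Proof.
move=> ul; have [N HN] := ul _ ltr01; exists (nrm l + 1).
  by have := nrm_ge0 l; lra.
exists N => n /HN h; rewrite -[u n](subrK l) (le_trans (nrmD _ _)) //; lra.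
Qed.

Lemma tends_shift u l : tends u l -> tends (fun n => u n.+1) l.
Proof. by move=> ul e /ul[N HN]; exists N => n Nn; apply: HN; apply: leqW. Qed.

Lemma tends_cst l : tends (fun=> l) l.
Proof. by move=> e e0; exists 0 => n _; rewrite subrr nrm0. Qed.

Lemma tendsMl a u l : tends u l -> tends (fun n => a * u n) (a * l).
Proof.
apply: (@tends_lip _ _ (fun b => a * b) (nrm a)) => b c.
by rewrite -mulrBr nrmM.
Qed.

Lemma tendsMr a u l : tends u l -> tends (fun n => u n * a) (l * a).
Proof.
apply: (@tends_lip _ _ (fun b => b * a) (nrm a)) => b c.
by rewrite -mulrBl mulrC nrmM.
Qed.

Lemma tends_rsc t u l : tends u l -> tends (fun n => rsc t (u n)) (rsc t l).
Proof.
apply: (@tends_lip _ _ (rsc t) `|t|) => b c.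
by rewrite -rscBr nrm_rsc.
Qed.

Lemma tends_star u l : tends u l -> tends (fun n => star (u n)) (star l).
Proof.
apply: (@tends_lip _ _ (@star _ _) 1) => b c.
by rewrite -starB nrm_star mul1r.
Qed.

Lemma tendsM u v l m : tends u l -> tends v m ->
  tends (fun n => u n * v n) (l * m).
Proof.
move=> ul vm.
have z : tends (fun n => (u n - l) * v n) 0.
  have [C C0 [M HC]] := tends_nrm_bounded vm.
  move=> e e0; have [N HN] := ul _ (divr_gt0 e0 C0).
  exists (maxn M N) => n; rewrite geq_max => /andP[/HC h1 /HN h2]; rewrite subr0.
  rewrite (le_lt_trans (nrmM _ _)) //.
  apply: (@le_lt_trans _ _ (nrm (u n - l) * C)).
    by rewrite ler_wpM2l // nrm_ge0.
  by rewrite -ltr_pdivlMr.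
have := tendsD z (tendsMl l vm); rewrite add0r.
by under eq_fun do rewrite mulrBl subrK.
Qed.

End Limits.

(** * Square roots near the unit *)

Section Positivity.
Context {R : realType} {A : cstarAlgType R}.
Implicit Types (a b c h k l x y : A) (t : R).

Definition sa h := star h = h.

(** Squares of self-adjoint elements: the positive cone, in the form that
    needs no spectrum. *)
Definition pos h := exists2 k, sa k & h = k * k.

Lemma saD h k : sa h -> sa k -> sa (h + k).
Proof. by rewrite /sa starD => -> ->. Qed.

Lemma saB h k : sa h -> sa k -> sa (h - k).
Proof. by rewrite /sa starB => -> ->. Qed.

Lemma saN h : sa h -> sa (- h).
Proof. by rewrite /sa starN => ->. Qed.

Lemma sa_rsc t h : sa h -> sa (rsc t h).
Proof. by rewrite /sa star_rsc => ->. Qed.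

Lemma sa_rsc1 t : sa (rsc t 1).
Proof. exact/sa_rsc/star1. Qed.

Lemma sa_sq h : sa h -> sa (h * h).
Proof. by rewrite /sa starM => ->. Qed.

Lemma sa_starM a : sa (star a * a).
Proof. by rewrite /sa starM starK. Qed.

Lemma pos_sa h : pos h -> sa h.
Proof. by move=> [k /sa_sq sk ->]. Qed.

(** The fixed point y of y = (x + y^2) / 2 satisfies (1 - y)^2 = 1 - x.  The
    scalar iteration for x = 1 increases to 1 and dominates, term by term, the
    iteration in A for any x of norm at most 1. *)
Fixpoint sqrt_scalar (n : nat) : R :=
  if n is m.+1 then (1 + sqrt_scalar m ^+ 2) / 2 else 0.

Fixpoint sqrt_approx x (n : nat) : A :=
  if n is m.+1 then rsc (2^-1) (x + sqrt_approx x m * sqrt_approx x m) else 0.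

Lemma sqrt_scalar_itv n : 0 <= sqrt_scalar n <= 1.
Proof. by elim: n => [|n] /=; [rewrite lexx ler01|nra]. Qed.

Lemma sqrt_scalar_le n : sqrt_scalar n <= sqrt_scalar n.+1.
Proof. by rewrite /=; have := sqr_ge0 (sqrt_scalar n - 1); nra. Qed.

Lemma sqrt_scalar_cauchy (e : R) : 0 < e -> exists N, forall m n,
  (N <= m)%N -> (m <= n)%N -> sqrt_scalar n - sqrt_scalar m < e.
Proof.
move=> e0.
have hs : has_sup (range sqrt_scalar).
  split; first by exists (sqrt_scalar 0); exists 0.
  by exists 1 => _ [n _ <-]; have /andP[] := sqrt_scalar_itv n.
have [_ [N _ <-] hN] := sup_adherent e0 hs.
have mono : {homo sqrt_scalar : m n / (m <= n)%N >-> m <= n}.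
  by apply: homo_leq => //; [exact: le_trans|exact: sqrt_scalar_le].
exists N => m n Nm mn; have := mono _ _ Nm.
have : sqrt_scalar n <= sup (range sqrt_scalar) by apply: ub_le_sup; [case: hs|exists n].
lra.
Qed.

Lemma sqrt_approx_comm x n c : GRing.comm c x -> GRing.comm c (sqrt_approx x n).
Proof.
move=> cx; elim: n => [|n IH] /=; first exact: commr0.
by rewrite /GRing.comm rscAr rscAl; congr rsc; apply: commrD => //; apply: commrM.
Qed.

Lemma sqrt_approx_comm2 x n m : GRing.comm (sqrt_approx x n) (sqrt_approx x m).
Proof. by apply: sqrt_approx_comm; apply/commr_sym/sqrt_approx_comm. Qed.

Lemma sqrt_approx_nrm x n : nrm x <= 1 -> nrm (sqrt_approx x n) <= sqrt_scalar n.
Proof.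
move=> x1; elim: n => [|n IH] /=; first by rewrite nrm0.
rewrite nrm_rsc ger0_norm ?invr_ge0 // mulrC ler_pM2r ?invr_gt0 //.
rewrite (le_trans (nrmD _ _)) // lerD // (le_trans (nrmM _ _)) // expr2.
by rewrite ler_pM // nrm_ge0.
Qed.

(** The difference of two consecutive squares factors because the iterates
    commute. *)
Lemma sqrt_approx_dist x n : nrm x <= 1 ->
  nrm (sqrt_approx x n.+1 - sqrt_approx x n) <= sqrt_scalar n.+1 - sqrt_scalar n.
Proof.
move=> x1; elim: n => [|n IH].
  rewrite /= mul0r addr0 subr0 expr0n addr0 subr0 nrm_rsc.
  by rewrite ger0_norm ?invr_ge0 // mulrC ler_pM2r ?invr_gt0.
have cm := sqrt_approx_comm2 x n n.+1.
have n1 := sqrt_approx_nrm n.+1 x1; have n0 := sqrt_approx_nrm n x1.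
have p1 := sqrt_scalar_le n.
rewrite -[sqrt_approx x n.+2]/(rsc _ (x + sqrt_approx x n.+1 * sqrt_approx x n.+1)).
rewrite {2}[sqrt_approx x n.+1]/(rsc _ (x + sqrt_approx x n * sqrt_approx x n)).
set u := sqrt_approx x n.+1 in cm IH n1 *; set v := sqrt_approx x n in cm IH n0 *.
have -> : rsc 2^-1 (x + u * u) - rsc 2^-1 (x + v * v) =
   rsc 2^-1 ((u + v) * (u - v)).
  rewrite -rscBr mulrDl !mulrBr cm; congr rsc.
  by rewrite addrA subrK opprD addrACA subrr add0r.
rewrite nrm_rsc ger0_norm ?invr_ge0 //.
have := nrmM (u + v) (u - v); have := nrmD u v.
have := nrm_ge0 (u - v).
have e1 : sqrt_scalar n.+2 = (1 + sqrt_scalar n.+1 ^+ 2) / 2 by [].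
have e0 : sqrt_scalar n.+1 = (1 + sqrt_scalar n ^+ 2) / 2 by [].
rewrite e1; move: e0 n0 n1 p1 IH.
move: (sqrt_scalar n) (sqrt_scalar n.+1) => s s1 e0 n0 n1 p1 IH g0 g1 g2.
have : nrm (u + v) * nrm (u - v) <= (s1 + s) * (s1 - s).
  by apply: ler_pM => //; rewrite ?nrm_ge0 //; lra.
nra.
Qed.

(** The bound |1 - h| <= 1 suffices, since the dominating scalar sequence
    converges.  The root commutes with the commutant of h because all
    approximations do. *)
Lemma sqrt_near1 h : sa h -> nrm (1 - h) <= 1 ->
  exists k, [/\ sa k, k * k = h, nrm (1 - k) <= 1 &
    forall c, GRing.comm c h -> GRing.comm c k].
Proof.
move=> sh h1; set x := 1 - h in h1.
have [|y yl] := @cauchy_tends _ _ (sqrt_approx x).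
  move=> e /sqrt_scalar_cauchy[N HN]; exists N => m n Nm mn.
  apply: le_lt_trans (HN _ _ Nm mn).
  elim: n mn => [|n IH]; first by rewrite leqn0 => /eqP ->; rewrite !subrr nrm0.
  rewrite leq_eqVlt => /orP[/eqP ->|/IH {}IH]; first by rewrite !subrr nrm0.
  have -> : sqrt_approx x n.+1 - sqrt_approx x m =
     (sqrt_approx x n.+1 - sqrt_approx x n) + (sqrt_approx x n - sqrt_approx x m).
    by rewrite addrA subrK.
  rewrite (le_trans (nrmD _ _)) //; have := sqrt_approx_dist n h1; lra.
have yE : y = rsc 2^-1 (x + y * y).
  apply: (tends_uniq (tends_shift yl)) => /=.
  by apply: tends_rsc; apply: tendsD; [exact: tends_cst|exact: tendsM].
have sx : sa x by apply: saB => //; exact: star1.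
exists (1 - y); split.
- apply: saB; first exact: star1.
  have sn n : sa (sqrt_approx x n).
    elim: n => [|n IH] /=; first exact: star0.
    by apply: sa_rsc; apply: saD => //; apply: sa_sq.
  rewrite /sa; apply: (tends_uniq _ yl).
  by have := tends_star yl; under [fun _ => _]eq_fun do rewrite sn.
- have e2 : y + y = x + y * y.
    by rewrite {1 2}yE -rscDl -[RHS]rsc1; congr rsc; field.
  rewrite mulrBl mul1r mulrBr mulr1 opprB addrC -addrA.
  have -> : - y + (1 - y) = 1 - (y + y) by rewrite opprD addrCA.
  by rewrite e2 opprD addrCA [X in 1 + X]addrCA subrr addr0 /x opprB addrC subrK.
- rewrite opprB addrC subrK; apply: (tends_nrm_le yl).
  exists 0 => n _; rewrite (le_trans (sqrt_approx_nrm n h1)) //.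
  by have /andP[] := sqrt_scalar_itv n.
- move=> c ch; apply: commrB; first exact: commr1.
  have cx : GRing.comm c x by apply: commrB => //; exact: commr1.
  apply: tends_uniq (tendsMl c yl) _.
  by under eq_fun do rewrite (sqrt_approx_comm _ cx); exact: tendsMr.
Qed.

Lemma rscV t a : t != 0 -> rsc t (rsc t^-1 a) = a.
Proof. by move=> t0; rewrite rscA divff // rsc1. Qed.

Lemma sqrt_near t h : 0 < t -> sa h -> nrm (rsc t 1 - h) <= t ->
  exists k, [/\ sa k, k * k = h, pos k &
    forall c, GRing.comm c h -> GRing.comm c k].
Proof.
move=> t0 sh ht; have tn0 := lt0r_neq0 t0.
have [||k [sk kk k1 kc]] := @sqrt_near1 (rsc t^-1 h).
- exact: sa_rsc.
- have -> : 1 - rsc t^-1 h = rsc t^-1 (rsc t 1 - h).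
    by rewrite rscBr rscA mulVf // rsc1.
  by rewrite nrm_rsc gtr0_norm ?invr_gt0 // ler_pdivrMl // mulr1.
have s0 : 0 <= Num.sqrt t by exact: sqrtr_ge0.
exists (rsc (Num.sqrt t) k); split.
- exact: sa_rsc.
- by rewrite rscAl rscAr rscA kk -expr2 sqr_sqrtr ?ltW // rscV.
- have [l [sl ll _ _]] := sqrt_near1 sk k1.
  exists (rsc (Num.sqrt (Num.sqrt t)) l); first exact: sa_rsc.
  by rewrite rscAl rscAr rscA ll -expr2 sqr_sqrtr.
- move=> c ch; rewrite /GRing.comm rscAr rscAl; congr rsc; apply: kc.
  by rewrite /GRing.comm rscAr rscAl ch.
Qed.

End Positivity.

(** * The positive cone *)

Section Cone.
Context {R : realType} {A : cstarAlgType R}.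
Implicit Types (a b c h k l x y : A) (t : R).

Lemma pos_near t h : 0 < t -> sa h -> nrm (rsc t 1 - h) <= t -> pos h.
Proof. by move=> t0 sh /(sqrt_near t0 sh)[k [sk kk _ _]]; exists k. Qed.

Definition isc a : A := 'i%C *: a.

Lemma isc_sa a : star (isc a) = - isc (star a).
Proof.
rewrite /isc {1}/star cstar_starZ -scaleNr; congr (_ *: _).
by rewrite /= ; congr Complex; rewrite oppr0.
Qed.

Lemma iscAl a b : isc a * b = isc (a * b).
Proof. exact: cstar_scaleAl. Qed.

Lemma iscAr a b : a * isc b = isc (a * b).
Proof. exact: cstar_scaleAr. Qed.

Lemma iscK a : isc (isc a) = - a.
Proof. by rewrite /isc scalerA -expr2 sqr_i scaleN1r. Qed.

(** The element k + i l is a multiple of a unitary, and k is its real part. *)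
Lemma circle_nrm_le t k l : 0 <= t -> sa k -> sa l -> GRing.comm k l ->
  k * k + l * l = rsc t 1 -> nrm (k * k) <= t.
Proof.
move=> t0 sk sl kl e; pose u := k + isc l.
have su : star u = k - isc l by rewrite starD sk isc_sa sl.
have uu : nrm u ^+ 2 <= t.
  rewrite -nrm_starM su mulrBl !mulrDr iscAl !iscAr iscAl iscK kl.
  have -> : k * k + isc (l * k) - (isc (l * k) + - (l * l)) = k * k + l * l by zmodule.
  by rewrite e nrm_rsc1.
have ku : nrm k <= nrm u.
  have -> : k = rsc 2^-1 (u + star u).
    by rewrite su /u addrACA subrr addr0 rscDr -rscDl -[LHS]rsc1; congr rsc; field.
  rewrite nrm_rsc ger0_norm ?invr_ge0 // mulrC ler_pdivrMr //.
  rewrite (le_trans (nrmD _ _)) // nrm_star; lra.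
rewrite nrm_sa_sq // (le_trans _ uu) // ler_sqr ?nnegrE ?nrm_ge0 //.
Qed.

(** The converse of [pos_near]: the complement t - k^2 has a square root
    commuting with k, which puts both roots on a circle. *)
Lemma pos_dist t h : 0 < t -> pos h -> nrm h <= t -> nrm (rsc t 1 - h) <= t.
Proof.
move=> t0 [k sk ->] kt.
have sh : sa (rsc t 1 - k * k) by apply: saB; [exact: sa_rsc1|exact: sa_sq].
have [|l [sl ll _ lc]] := sqrt_near t0 sh; first by rewrite subKr.
rewrite -ll; apply: (circle_nrm_le (ltW t0) sl sk).
  apply/commr_sym/lc; apply: commrB; last by apply: commrM.
  by rewrite /GRing.comm rscAl rscAr mulr1 mul1r.
by rewrite ll subrK.
Qed.

Lemma pos_sqrt h : pos h -> exists k, [/\ sa k, k * k = h, pos k &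
    forall c, GRing.comm c h -> GRing.comm c k].
Proof.
move=> ph; have t0 : 0 < nrm h + 1 by have := nrm_ge0 h; lra.
apply: (sqrt_near t0); first exact: pos_sa.
by apply: pos_dist => //; rewrite lerDl.
Qed.

Lemma posD h k : pos h -> pos k -> pos (h + k).
Proof.
move=> ph pk.
have s0 : 0 < nrm h + 1 by have := nrm_ge0 h; lra.
have t0 : 0 < nrm k + 1 by have := nrm_ge0 k; lra.
have H := pos_dist s0 ph; have K := pos_dist t0 pk.
apply: (@pos_near (nrm h + 1 + (nrm k + 1))); first exact: addr_gt0.
  by apply: saD; exact: pos_sa.
rewrite rscDl opprD addrACA (le_trans (nrmD _ _)) // lerD //.
  by apply: H; rewrite lerDl.
by apply: K; rewrite lerDl.
Qed.

Lemma pos0 : pos (0 : A).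
Proof. by exists 0; [exact: star0|rewrite mulr0]. Qed.

Lemma pos_rsc t h : 0 <= t -> pos h -> pos (rsc t h).
Proof.
move=> t0 [k sk ->]; exists (rsc (Num.sqrt t) k); first exact: sa_rsc.
by rewrite rscAl rscAr rscA -(expr2 (Num.sqrt t)) sqr_sqrtr.
Qed.

(** For t slightly above |b| both a and t - a = (t - b) + (b - a) have square
    roots, and these commute; [circle_nrm_le] then bounds a by t. *)
Lemma pos_le_nrm a b : pos a -> pos (b - a) -> nrm a <= nrm b.
Proof.
move=> pa pba; have pb : pos b by have := posD pa pba; rewrite addrC subrK.
apply/ler_addgt0Pr => e e0; set t := nrm b + e.
have t0 : 0 < t by have := nrm_ge0 b; rewrite /t; lra.
have pt : pos (rsc t 1 - b).
  apply: (pos_near t0); last by rewrite subKr /t; lra.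
  by apply: saB; [exact: sa_rsc1|exact: pos_sa].
have [k [sk kk _ kc]] := pos_sqrt pa.
have pta : pos (rsc t 1 - a) by have := posD pt pba; rewrite addrA subrK.
have [l [sl ll _ lc]] := pos_sqrt pta.
rewrite -kk; apply: (circle_nrm_le (ltW t0) sk sl); last first.
  by rewrite kk ll addrC subrK.
apply: lc; apply: commrB; first by rewrite /GRing.comm rscAl rscAr mulr1 mul1r.
by apply/commr_sym/kc.
Qed.

Lemma bernoulli (d : R) n : 0 <= d -> 1 + n%:R * d <= (1 + d) ^+ n.
Proof.
move=> d0; elim: n => [|n IH]; first by rewrite mul0r addr0 expr0.
have n0 : 0 <= n%:R * d by rewrite mulr_ge0.
rewrite exprS -natr1.
apply: (@le_trans _ _ ((1 + d) * (1 + n%:R * d))); first nra.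
by rewrite ler_wpM2l // addr_ge0.
Qed.

(** A power sequence that grows at most linearly along the powers of 2 has
    ratio at most 1, since (1 + d)^(2 M) >= M^2 d^2. *)
Lemma subexp_le1 (r C : R) : 0 <= C ->
  (forall n, r ^+ (2 ^ n) <= 1 + (2 ^ n)%:R * C) -> r <= 1.
Proof.
move=> C0 H; rewrite leNgt; apply/negP => r1.
pose d := r - 1; have d0 : 0 < d by rewrite subr_gt0.
have [n Hn] : exists n : nat, (1 + 2 * C) / d ^+ 2 < n%:R.
  exists (Num.bound ((1 + 2 * C) / d ^+ 2)).
  by rewrite archi_boundP // divr_ge0 ?sqr_ge0 //; lra.
pose M : R := (2 ^ n)%:R.
have M1 : 1 <= M by rewrite ler1n expn_gt0.
have nM : n%:R < M by rewrite ltr_nat ltn_expl.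
have := H n.+1; rewrite expnS natrM -/M mulnC exprM.
have := @bernoulli d (2 ^ n) (ltW d0); rewrite -/M.
rewrite (_ : 1 + d = r) => [B|]; last by rewrite /d; ring.
have : (1 + 2 * C) < M * d ^+ 2.
  by rewrite -ltr_pdivrMr ?exprn_gt0 // (lt_trans Hn).
move=> h1 h2.
have h3 : (M * d) ^+ 2 <= (r ^+ (2 ^ n)) ^+ 2.
  rewrite ler_sqr ?nnegrE ?mulr_ge0 ?exprn_ge0 //; lra.
have h4 : M * (1 + 2 * C) < M * (M * d ^+ 2) by rewrite ltr_pM2l //; lra.
nra.
Qed.

Lemma nrm_sa_exp2 h n : sa h -> nrm (h ^+ (2 ^ n)) = nrm h ^+ (2 ^ n).
Proof.
move=> sh; elim: n => [|n IH]; first by rewrite !expr1.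
rewrite expnS mulnC !exprM -IH expr2 nrm_sa_sq //.
rewrite /sa; elim: (2 ^ n)%N => [|m IHm]; first exact: star1.
by rewrite {1}exprSr starM sh IHm -exprS.
Qed.

(** The two self-adjoint elements have the same spectral radius: the powers of
    t + b b^* are those of t + b^* b conjugated by b, up to factors that
    grow only linearly in the exponent. *)
Lemma nrm_shift_swap t b : 0 < t -> nrm (rsc t 1 + star b * b) <= t ->
  nrm (rsc t 1 + b * star b) <= t.
Proof.
move=> t0 zt; set z := rsc t 1 + star b * b in zt; set z' := rsc t 1 + _.
have sz : sa z'.
  by apply: saD; [exact: sa_rsc1|rewrite /sa starM starK].
have swap : star b * z' = z * star b.
  by rewrite mulrDr mulrDl rscAl rscAr mulr1 mul1r mulrA.
(* q is the sum of the t^(n - 1 - j) (t + b^* b)^j for j < n; its bound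
   is multiplied by t so as to keep the exponent n. *)
have Hq n : exists2 q : A, nrm q * t <= n%:R * t ^+ n &
    z' ^+ n = rsc (t ^+ n) 1 + b * q * star b.
  elim: n => [|n [q qt e]].
    exists 0; first by rewrite nrm0 !mul0r.
    by rewrite !expr0 rsc1 mulr0 mul0r addr0.
  exists (q * z + rsc (t ^+ n) 1).
    rewrite exprS -natr1.
    have h1 : nrm (q * z) <= nrm q * t.
      by rewrite (le_trans (nrmM _ _)) // ler_wpM2l // nrm_ge0.
    have h2 : nrm (rsc (t ^+ n) (1 : A)) <= t ^+ n.
      by apply: nrm_rsc1; exact: exprn_ge0 (ltW _).
    apply: (@le_trans _ _ ((n%:R * t ^+ n + t ^+ n) * t)); last first.
      by rewrite le_eqVlt; apply/orP; left; apply/eqP; ring.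
    rewrite ler_pM2r // (le_trans (nrmD _ _)) // lerD // (le_trans h1) //.
  rewrite exprSr e mulrDl rscAl mul1r -mulrA swap.
  rewrite (_ : z' = rsc t 1 + b * star b) // rscDr rscA.
  rewrite -exprSr -addrA; congr (_ + _).
  rewrite mulrDr mulrDl !mulrA addrC; congr (_ + _).
  by rewrite rscAr mulr1 rscAl.
pose C := nrm b ^+ 2 / t.
have C0 : 0 <= C by rewrite divr_ge0 ?sqr_ge0 ?ltW.
suff : nrm z' / t <= 1 by rewrite ler_pdivrMr // mul1r.
apply: (subexp_le1 C0) => n.
rewrite expr_div_n -nrm_sa_exp2 // ler_pdivrMr ?exprn_gt0 //.
have [q qt ->] := Hq (2 ^ n)%N.
rewrite (le_trans (nrmD _ _)) // mulrDl mul1r lerD //.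
  by apply: nrm_rsc1; exact: exprn_ge0 (ltW _).
rewrite (le_trans (nrmM _ _)) // nrm_star.
have h : nrm (b * q) * nrm b <= nrm b * nrm q * nrm b.
  by rewrite ler_wpM2r ?nrmM // nrm_ge0.
rewrite (le_trans h) //.
have -> : nrm b * nrm q * nrm b = C * (nrm q * t) by rewrite /C; field; rewrite gt_eqF.
rewrite [leRHS](_ : _ = C * ((2 ^ n)%:R * t ^+ (2 ^ n))); last by ring.
exact: ler_wpM2l.
Qed.

Lemma posN_swap b : pos (- (star b * b)) -> pos (- (b * star b)).
Proof.
move=> p; set t := nrm (star b * b) + 1.
have t0 : 0 < t by have := nrm_ge0 (star b * b); rewrite /t; lra.
apply: (pos_near t0); first by apply: saN; rewrite /sa starM starK.
rewrite opprK; apply: nrm_shift_swap => //.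
by rewrite -[star b * b]opprK; apply: pos_dist => //; rewrite nrmN /t; lra.
Qed.

Lemma sa_sq_eq0 h : sa h -> h * h = 0 -> h = 0.
Proof.
move=> sh hh; apply: nrm0_eq0; have := nrm_sa_sq sh; rewrite hh nrm0.
have := nrm_ge0 h; nra.
Qed.

(** If -b^* b is positive, so is -b b^* by [posN_swap], while
    b b^* + b^* b = (x^2 + y^2) / 2 for the self-adjoint x = b + b^* and
    y = i (b - b^* ) makes b b^* positive as well. *)
Lemma posN_starM_eq0 b : pos (- (star b * b)) -> b = 0.
Proof.
move=> p; have pn := posN_swap p.
have ps : pos (b * star b + star b * b).
  have -> : b * star b + star b * b = rsc 2^-1 ((b + star b) * (b + star b)
      + isc (b - star b) * isc (b - star b)).
    set p1 := b * star b; set p2 := star b * b.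
    have -> : (b + star b) * (b + star b) + isc (b - star b) * isc (b - star b) =
        (p1 + p2) + (p1 + p2).
      rewrite iscAl iscAr iscK !(mulrDl, mulrDr, mulNr, mulrN).
      by rewrite -/p1 -/p2; zmodule.
    by rewrite rscDr -rscDl -[LHS]rsc1; congr rsc; field.
  apply: pos_rsc; first by rewrite invr_ge0.
  apply: posD; first by exists (b + star b) => //; rewrite /sa starD starK addrC.
  exists (isc (b - star b)) => //.
  by rewrite /sa isc_sa starB starK -scalerN opprB.
have pb : pos (b * star b).
  by have := posD ps p; rewrite addrK.
have := @pos_le_nrm (b * star b) 0 pb; rewrite sub0r => /(_ pn).
have := nrm_starM (star b); rewrite starK nrm0 nrm_star => ->.
by have := nrm_ge0 b => b0 b2; apply: nrm0_eq0; nra.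
Qed.

(** Let s be the square root of h^2, where h = a^* a; the claim is h = s.  The
    element w = s - h is twice the negative part of h, and (a w)^* (a w)
    = - w s w is negative, so that a w = 0 by [posN_starM_eq0] and w = 0. *)
Theorem pos_starM a : pos (star a * a).
Proof.
set h := star a * a.
have sh : sa h by exact: sa_starM.
have [s [ss e ps sc]] : exists s, [/\ sa s, s * s = h * h, pos s &
    forall c, GRing.comm c (h * h) -> GRing.comm c s].
  by apply: pos_sqrt; exists h.
have hs : h * s = s * h by apply: sc; rewrite /GRing.comm mulrA.
(* s h = h s, so that h and its absolute value s generate a commutative
   algebra, in which w is killed by s + h. *)
pose w := s - h.
have sw : sa w by exact: saB.
have w2 : w * w = s * w + s * w.
  by rewrite /w !(mulrDl, mulrDr, mulNr, mulrN) hs e; zmodule.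
have hw : h * w = - (s * w).
  by rewrite /w !(mulrDl, mulrDr, mulNr, mulrN) hs e; zmodule.
have [m [sm mm _ mc]] := pos_sqrt ps.
have wm : w * m = m * w.
  by apply: mc; apply/commr_sym; apply: commrB => //; apply: commr_sym.
have wsw : w * (s * w) = (m * w) * (m * w) by rewrite -mm !mulrA wm.
have smw : sa (m * w) by rewrite /sa starM sm sw.
have aw : a * w = 0.
  apply: posN_starM_eq0; exists (m * w) => //.
  by rewrite starM sw -mulrA [star a * _]mulrA -/h hw mulrN opprK.
have mw0 : m * w = 0.
  apply: sa_sq_eq0 => //; rewrite -wsw; apply: oppr_inj.
  by rewrite -mulrN -hw /h -mulrA aw !mulr0 oppr0.
have w0 : w = 0.
  by apply: sa_sq_eq0 => //; rewrite w2 -mm -mulrA mw0 mulr0 addr0.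
by have -> : h = s by apply/esym/eqP; rewrite -subr_eq0 -/w w0.
Qed.

Lemma pos_conj h c : pos h -> pos (star c * h * c).
Proof.
move=> [k sk ->]; have := pos_starM (k * c).
by rewrite starM sk !mulrA.
Qed.

Lemma pos_sum I (r : seq I) (P : pred I) (F : I -> A) :
  (forall i, P i -> pos (F i)) -> pos (\sum_(i <- r | P i) F i).
Proof. by move=> h; elim/big_ind : _ => //; [exact: pos0|exact: posD]. Qed.

End Cone.

(** * The Cauchy-Schwarz inequality and the standard module *)

Section FiniteSums.
Context {R : realType} {A : cstarAlgType R}.
Implicit Types (x y : cseq A) (r : seq nat) (a : A).

Definition ip r x y : A := \sum_(i <- r) star (x i) * y i.

Definition sn r x : R := Num.sqrt (nrm (ip r x x)).

Lemma ip_pos r x : pos (ip r x x).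
Proof. by apply: pos_sum => i _; exact: pos_starM. Qed.

Lemma ipDl r x y z : ip r (x + y) z = ip r x z + ip r y z.
Proof. by rewrite -big_split; apply: eq_bigr => i _; rewrite starD mulrDl. Qed.

Lemma ipDr r x y z : ip r x (y + z) = ip r x y + ip r x z.
Proof. by rewrite -big_split; apply: eq_bigr => i _; rewrite mulrDr. Qed.

Lemma ipNl r x y : ip r (- x) y = - ip r x y.
Proof. by rewrite -sumrN; apply: eq_bigr => i _; rewrite starN mulNr. Qed.

Lemma ipNr r x y : ip r x (- y) = - ip r x y.
Proof. by rewrite -sumrN; apply: eq_bigr => i _; rewrite mulrN. Qed.

Lemma star_ip r x y : star (ip r x y) = ip r y x.
Proof. by rewrite star_sum; apply: eq_bigr => i _; rewrite starM starK. Qed.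

Lemma ip_rscale r x y a b :
  ip r (rscale x a) (rscale y b) = star a * ip r x y * b.
Proof.
rewrite /ip mulr_sumr mulr_suml; apply: eq_bigr => i _.
by rewrite starM !mulrA.
Qed.

Lemma rscale1 x : rscale x 1 = x.
Proof. by apply/funext => i; rewrite /rscale mulr1. Qed.

(** Expanding the positive <x a - y, x a - y> at a = <x, y> / t, where t is at
    least the norm of <x, x>, gives <x, y>^* <x, y> <= t <y, y>. *)
Lemma ip_CS r x y :
  nrm (ip r x y) ^+ 2 <= nrm (ip r x x) * nrm (ip r y y).
Proof.
set c := ip r x y; set p := ip r x x; set q := ip r y y.
suff H t : 0 < t -> nrm p <= t -> nrm c ^+ 2 <= t * nrm q.
  apply/ler_addgt0Pr => e e0.
  have q1 : 0 < nrm q + 1 by have := nrm_ge0 q; lra.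
  apply: (le_trans (H (nrm p + e / (nrm q + 1)) _ _)).
  - by rewrite ltr_wpDl ?nrm_ge0 // divr_gt0.
  - by rewrite lerDl ltW // divr_gt0.
  - rewrite mulrDl lerD2l -mulrA ler_piMr ?(ltW e0) //.
    by rewrite mulrC ler_pdivrMr // mul1r; lra.
move=> t0 pt; have tn : t != 0 by rewrite gt_eqF.
rewrite -nrm_starM -ler_pdivrMl //.
have -> : t^-1 * nrm (star c * c) = nrm (rsc t^-1 (star c * c)).
  by rewrite nrm_rsc gtr0_norm ?invr_gt0.
apply: pos_le_nrm.
  by apply: pos_rsc; [rewrite invr_ge0 ltW|exact: pos_starM].
(* The correction by h2 replaces a^* p a by t a^* a. *)
pose a := rsc t^-1 c.
have h1 : pos (ip r (rscale x a - y) (rscale x a - y)) by exact: ip_pos.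
have h2 : pos (star a * (rsc t 1 - p) * a).
  apply: pos_conj; apply: (pos_near t0); last by rewrite subKr.
  by apply: saB; [exact: sa_rsc1|exact: pos_sa (ip_pos _ _)].
have := posD h1 h2; congr pos.
rewrite ipDl !ipDr !ipNl !ipNr ip_rscale -/p.
rewrite -[X in ip _ X (rscale _ _)]rscale1 -[X in ip _ (rscale _ _) X]rscale1 !ip_rscale.
rewrite star1 mul1r mulr1 -/q -/c -[ip r y x]star_ip -/c.
have e1 : star a * c = rsc t^-1 (star c * c) by rewrite star_rsc rscAl.
have e2 : star c * a = rsc t^-1 (star c * c) by rewrite rscAr.
have e3 : star a * rsc t 1 * a = rsc t^-1 (star c * c).
  by rewrite rscAr mulr1 rscAl /a star_rsc rscAl rscV // rscAr.
rewrite e1 e2 mulrBr mulrBl e3; zmodule.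
Qed.

Lemma sn_ge0 r x : 0 <= sn r x.
Proof. exact: sqrtr_ge0. Qed.

Lemma sn_sqr r x : sn r x ^+ 2 = nrm (ip r x x).
Proof. by rewrite sqr_sqrtr // nrm_ge0. Qed.

Lemma ip_le r x y : nrm (ip r x y) <= sn r x * sn r y.
Proof.
rewrite -ler_sqr ?nnegrE ?mulr_ge0 ?sn_ge0 ?nrm_ge0 // exprMn !sn_sqr.
exact: ip_CS.
Qed.

Lemma snD r x y : sn r (x + y) <= sn r x + sn r y.
Proof.
rewrite -ler_sqr ?nnegrE ?addr_ge0 ?sn_ge0 // sn_sqr ipDl !ipDr.
have := ip_le r x y; have := ip_le r y x.
have := nrmD (ip r x x + ip r x y) (ip r y x + ip r y y).
have := nrmD (ip r x x) (ip r x y); have := nrmD (ip r y x) (ip r y y).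
have := sn_sqr r x; have := sn_sqr r y; nra.
Qed.

Lemma snN r x : sn r (- x) = sn r x.
Proof. by rewrite /sn ipNl ipNr opprK. Qed.

Lemma sn_rscale r x a : sn r (rscale x a) <= sn r x * nrm a.
Proof.
rewrite -ler_sqr ?nnegrE ?mulr_ge0 ?sn_ge0 ?nrm_ge0 // exprMn !sn_sqr.
rewrite ip_rscale (le_trans (nrmM _ _)) //.
rewrite (_ : _ ^+ 2 = nrm a * nrm a) // mulrA ler_wpM2r ?nrm_ge0 //.
by rewrite (le_trans (nrmM _ _)) // nrm_star mulrC.
Qed.

Lemma ip_cat r1 r2 x y : ip (r1 ++ r2) x y = ip r1 x y + ip r2 x y.
Proof. by rewrite /ip big_cat. Qed.

Lemma sn_catl r1 r2 x : sn r1 x <= sn (r1 ++ r2) x.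
Proof.
rewrite ler_wsqrtr //; apply: pos_le_nrm; first exact: ip_pos.
rewrite ip_cat (_ : _ - _ = ip r2 x x); [exact: ip_pos|by zmodule].
Qed.

Lemma sn_catr r1 r2 x : sn r2 x <= sn (r1 ++ r2) x.
Proof.
rewrite ler_wsqrtr //; apply: pos_le_nrm; first exact: ip_pos.
rewrite ip_cat (_ : _ - _ = ip r1 x x); [exact: ip_pos|by zmodule].
Qed.

(** The seminorm carried by the coordinates from m to n - 1; membership in H_A
    and the norm of H_A are governed by these seminorms. *)
Definition sseg m n x := sn (index_iota m n) x.

Lemma index_iota_cat m n p : (m <= n)%N -> (n <= p)%N ->
  index_iota m p = index_iota m n ++ index_iota n p.
Proof.
move=> mn np; rewrite /index_iota.
have -> : (p - m = (n - m) + (p - n))%N by lia.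
by rewrite iotaD subnKC.
Qed.

Lemma sseg_mono m n p q x : (p <= m)%N -> (m <= n)%N -> (n <= q)%N ->
  sseg m n x <= sseg p q x.
Proof.
move=> pm mn nq; rewrite /sseg (@index_iota_cat p m q) ?(leq_trans mn) //.
rewrite (@index_iota_cat m n q) //.
exact: le_trans (sn_catl _ _ _) (sn_catr _ _ _).
Qed.

Lemma sseg_cat m n p x : (m <= n)%N -> (n <= p)%N ->
  sseg m p x ^+ 2 <= sseg m n x ^+ 2 + sseg n p x ^+ 2.
Proof.
move=> mn np; rewrite !sn_sqr (index_iota_cat mn np) ip_cat; exact: nrmD.
Qed.

Lemma sseg_eq m n x y : (forall i, (m <= i < n)%N -> x i = y i) ->
  sseg m n x = sseg m n y.
Proof.
move=> e; rewrite /sseg /sn /ip; congr (Num.sqrt (nrm _)).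
by apply: eq_big_nat => i /e ->.
Qed.

Lemma nrm_coord m n i x : (m <= i < n)%N -> nrm (x i) <= sseg m n x.
Proof.
move=> /andP[mi iN]; apply: le_trans (sseg_mono _ mi (leqnSn i) iN).
rewrite /sseg /index_iota subSnn /sn /ip big_seq1 nrm_starM sqrtr_sqr.
exact: ler_norm.
Qed.

End FiniteSums.

Section StandardModuleNorm.
Context {R : realType} {A : cstarAlgType R}.
Implicit Types (x y : cseq A) (a : A).

Lemma inner_partialE x y n : inner_partial x y n = ip (index_iota 0 n) x y.
Proof. by rewrite /ip big_mkord. Qed.

Lemma inner_partialB x m n : (m <= n)%N ->
  inner_partial x x n - inner_partial x x m = ip (index_iota m n) x x.
Proof.
move=> mn; rewrite !inner_partialE (@index_iota_cat 0 m n) // ip_cat.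
by zmodule.
Qed.

(** Summability as a Cauchy condition on seminorms; the triangle inequality
    for the latter is what makes H_A a module. *)
Lemma HA_tail x : HA x <-> (forall e : R, 0 < e -> exists N, forall m n,
   (N <= m)%N -> (m <= n)%N -> sseg m n x < e).
Proof.
split.
  move=> /cvg_ex[l /tends_cvg xl] e e0.
  have e2 : 0 < e ^+ 2 / 2 by rewrite divr_gt0 // exprn_gt0.
  have [N HN] := xl _ e2; exists N => m n Nm mn.
  rewrite -ltr_sqr ?nnegrE ?sn_ge0 ?ltW // sn_sqr -inner_partialB //.
  have h1 := HN _ Nm; have h2 := HN _ (leq_trans Nm mn).
  have -> : inner_partial x x n - inner_partial x x m =
     (inner_partial x x n - l) - (inner_partial x x m - l) by zmodule.
  by rewrite (le_lt_trans (nrmB _ _)) //; lra.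
move=> H; have [|l xl] := @cauchy_tends _ _ (inner_partial x x); last first.
  by apply/cvg_ex; exists l; apply/tends_cvg.
move=> e e0; have s0 : 0 < Num.sqrt e by rewrite sqrtr_gt0.
have [N HN] := H _ s0; exists N => m n Nm mn; rewrite inner_partialB //.
rewrite -sn_sqr -[e]sqr_sqrtr ?(ltW e0) // ltr_sqr ?nnegrE ?sn_ge0 ?ltW //.
exact: HN.
Qed.

Lemma inner_tends x : HA x -> tends (inner_partial x x) (inner x x).
Proof. by move=> hx; apply/tends_cvg. Qed.

Lemma sseg_le_l2norm x m n : HA x -> (m <= n)%N -> sseg m n x <= l2norm x.
Proof.
move=> hx mn; apply: (le_trans (sseg_mono _ (leq0n m) mn (leqnn n))).
rewrite ler_wsqrtr // -/(nrm (inner x x)) -inner_partialE.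
apply/ler_addgt0Pr => e e0; have [N HN] := inner_tends hx e0.
have nm := leq_maxl n N; have h := HN _ (leq_maxr n N).
have : nrm (inner_partial x x n) <= nrm (inner_partial x x (maxn n N)).
  apply: pos_le_nrm; first by rewrite inner_partialE; exact: ip_pos.
  by rewrite inner_partialB //; exact: ip_pos.
have -> : inner_partial x x (maxn n N) = inner x x +
  (inner_partial x x (maxn n N) - inner x x) by zmodule.
have := nrmD (inner x x) (inner_partial x x (maxn n N) - inner x x); lra.
Qed.

Lemma l2norm_le x c : HA x -> 0 <= c -> (forall n, sseg 0 n x <= c) ->
  l2norm x <= c.
Proof.
move=> hx c0 xc; rewrite -ler_sqr ?nnegrE ?sqrtr_ge0 //.
rewrite sqr_sqrtr ?(nrm_ge0 (inner x x)) //.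
apply: (tends_nrm_le (inner_tends hx)); exists 0 => n _.
by rewrite inner_partialE -sn_sqr ler_sqr ?nnegrE ?sn_ge0 //; exact: xc.
Qed.

Lemma HA0 : HA (0 : cseq A).
Proof.
apply/HA_tail => e e0; exists 0 => m n _ _.
by rewrite /sseg /sn /ip big1 ?nrm0 ?sqrtr0 // => i _; rewrite mulr0.
Qed.

Lemma HAD x y : HA x -> HA y -> HA (x + y).
Proof.
move=> /HA_tail hx /HA_tail hy; apply/HA_tail => e e0.
have e2 : 0 < e / 2 by rewrite divr_gt0.
have [N1 H1] := hx _ e2; have [N2 H2] := hy _ e2.
exists (maxn N1 N2) => m n; rewrite geq_max => /andP[l1 l2] mn.
have := H1 _ _ l1 mn; have := H2 _ _ l2 mn.
rewrite /sseg; have := snD (index_iota m n) x y; lra.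
Qed.

Lemma HAN x : HA x -> HA (- x).
Proof.
move=> /HA_tail hx; apply/HA_tail => e /hx[N HN]; exists N => m n Nm mn.
by rewrite /sseg snN; exact: HN.
Qed.

Lemma HAZ x a : HA x -> HA (rscale x a).
Proof.
move=> /HA_tail hx; apply/HA_tail => e e0.
have a1 : 0 < nrm a + 1 by have := nrm_ge0 a; lra.
have [N HN] := hx _ (divr_gt0 e0 a1); exists N => m n Nm mn.
apply: le_lt_trans (sn_rscale _ _ _) _.
have := HN _ _ Nm mn; rewrite ltr_pdivlMr //.
have := sn_ge0 (index_iota m n) x; have := nrm_ge0 a; rewrite /sseg; nra.
Qed.

End StandardModuleNorm.

(** * The standard module as a complete normed module *)

(** H_A as a type of its own.  Right modules over A are left modules over the
    converse ring. *)
Record hmod (R : realType) (A : cstarAlgType R) :=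
  HMod { hval :> cseq A; hvalP : HA hval }.

Arguments hvalP {R A} h.
Arguments HMod {R A hval} hvalP.

Section HModule.
Context {R : realType} {A : cstarAlgType R}.
Local Notation H := (hmod A).

HB.instance Definition _ := gen_eqMixin H.
HB.instance Definition _ := gen_choiceMixin H.

Lemma hval_inj : injective (@hval R A).
Proof.
by move=> [x hx] [y hy] /= e; case: y / e hy => hy; congr HMod; exact: Prop_irrelevance.
Qed.

Definition hzero : H := HMod HA0.
Definition hadd (x y : H) : H := HMod (HAD (hvalP x) (hvalP y)).
Definition hopp (x : H) : H := HMod (HAN (hvalP x)).
Definition hscale (a : A^c) (x : H) : H := HMod (HAZ (a := a) (hvalP x)).

Lemma haddA : associative hadd.
Proof. by move=> x y z; apply: hval_inj; exact: addrA. Qed.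
Lemma haddC : commutative hadd.
Proof. by move=> x y; apply: hval_inj; exact: addrC. Qed.
Lemma hadd0 : left_id hzero hadd.
Proof. by move=> x; apply: hval_inj; exact: add0r. Qed.
Lemma haddN : left_inverse hzero hopp hadd.
Proof. by move=> x; apply: hval_inj; exact: addNr. Qed.

HB.instance Definition _ := GRing.isZmodule.Build H haddA haddC hadd0 haddN.

Lemma hscaleA (a b : A^c) x : hscale a (hscale b x) = hscale (a * b) x.
Proof.
by apply: hval_inj; apply/funext => i; rewrite /= /rscale -mulrA.
Qed.
Lemma hscale1 : left_id 1 hscale.
Proof. by move=> x; apply: hval_inj; apply/funext => i; exact: mulr1. Qed.
Lemma hscaleDr : right_distributive hscale +%R.
Proof. by move=> a x y; apply: hval_inj; apply/funext => i; exact: mulrDl. Qed.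
Lemma hscaleDl x : {morph hscale^~ x : a b / a + b}.
Proof. by move=> a b; apply: hval_inj; apply/funext => i; exact: mulrDr. Qed.

HB.instance Definition _ := GRing.Zmodule_isLmodule.Build A^c H
  hscaleA hscale1 hscaleDr hscaleDl.

Implicit Types (x y z : H) (a : A^c).

Lemma hvalD x y : hval (x + y) = hval x + hval y. Proof. by []. Qed.
Lemma hvalN x : hval (- x) = - hval x. Proof. by []. Qed.
Lemma hvalB x y : hval (x - y) = hval x - hval y. Proof. by []. Qed.
Lemma hval0 : hval (0 : H) = 0. Proof. by []. Qed.
Lemma hvalZ a x : hval (a *: x) = rscale x a. Proof. by []. Qed.
Lemma hval_sum I (r : seq I) (P : pred I) (F : I -> H) :
  hval (\sum_(i <- r | P i) F i) = \sum_(i <- r | P i) hval (F i).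
Proof. exact: (big_morph _ hvalD hval0). Qed.

Definition hn x : R := l2norm (hval x).

Lemma hn_ge0 x : 0 <= hn x.
Proof. exact: sqrtr_ge0. Qed.

Lemma hn_le x c : 0 <= c -> (forall n, sseg 0 n x <= c) -> hn x <= c.
Proof. exact/l2norm_le/hvalP. Qed.

Lemma sseg_hn x m n : (m <= n)%N -> sseg m n x <= hn x.
Proof. exact/sseg_le_l2norm/hvalP. Qed.

Lemma hn0_eq0 x : hn x <= 0 -> x = 0.
Proof.
move=> x0; apply: hval_inj; apply/funext => i; apply: nrm0_eq0.
apply: (@le_trans _ _ (sseg i i.+1 x)); first by apply: nrm_coord; rewrite leqnn ltnSn.
exact: le_trans (sseg_hn x (leqnSn i)) x0.
Qed.

Lemma hnD x y : hn (x + y) <= hn x + hn y.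
Proof.
apply: hn_le => [|n]; first by rewrite addr_ge0 // hn_ge0.
by apply: le_trans (snD _ _ _) _; rewrite lerD // sseg_hn.
Qed.

Lemma hnN x : hn (- x) = hn x.
Proof.
suff le y : hn (- y) <= hn y by apply/eqP; rewrite eq_le le -{1}(opprK x) le.
apply: hn_le => [|n]; first exact: hn_ge0.
by rewrite /sseg hvalN snN sseg_hn.
Qed.

Lemma hnB x y : hn (x - y) <= hn x + hn y.
Proof. by rewrite -(hnN y) hnD. Qed.

Lemma hn_distC x y : hn (x - y) = hn (y - x).
Proof. by rewrite -hnN opprB. Qed.

Lemma hn0 : hn 0 = 0.
Proof.
apply/eqP; rewrite eq_le hn_ge0 andbT; apply: hn_le => // n.
by rewrite /sseg /sn /ip big1 ?nrm0 ?sqrtr0 // => i _; rewrite mulr0.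
Qed.

Lemma hnZ a x : hn (a *: x) <= hn x * nrm (a : A).
Proof.
apply: hn_le => [|n]; first by rewrite mulr_ge0 ?hn_ge0 ?nrm_ge0.
by apply: le_trans (sn_rscale _ _ _) _; rewrite ler_wpM2r ?nrm_ge0 // sseg_hn.
Qed.

Lemma hn_sum I (r : seq I) (P : pred I) (F : I -> H) :
  hn (\sum_(i <- r | P i) F i) <= \sum_(i <- r | P i) hn (F i).
Proof.
elim/big_ind2 : _ => [|x y z t h k|//]; first by rewrite hn0.
by rewrite (le_trans (hnD _ _)) // lerD.
Qed.

Definition hr (t : R) x : H := (rsc t 1 : A^c) *: x.

Lemma hn_hr t x : 0 <= t -> hn (hr t x) <= t * hn x.
Proof.
move=> t0; rewrite (le_trans (hnZ _ _)) // mulrC ler_wpM2r ?hn_ge0 //.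
exact: nrm_rsc1.
Qed.

Lemma hrA s t x : hr s (hr t x) = hr (s * t) x.
Proof.
rewrite /hr scalerA; congr (_ *: _).
by rewrite -[LHS]/(rsc t (1 : A) * rsc s 1) rscAr mulr1 rscA.
Qed.

Lemma hr1 x : hr 1 x = x.
Proof. by rewrite /hr rsc1 scale1r. Qed.

Lemma hrBr t x y : hr t (x - y) = hr t x - hr t y.
Proof. exact: scalerBr. Qed.

Definition htends (u : nat -> H) l :=
  forall e : R, 0 < e -> exists N, forall n, (N <= n)%N -> hn (u n - l) < e.

Definition hcauchy (u : nat -> H) :=
  forall e : R, 0 < e -> exists N, forall m n, (N <= m)%N -> (m <= n)%N ->
    hn (u n - u m) < e.

Lemma tends_ip (u : nat -> cseq A) (x : cseq A) r :
  (forall i, tends (u^~ i) (x i)) -> tends (fun n => ip r (u n) (u n)) (ip r x x).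
Proof.
move=> ux; elim: r => [|i r IH].
  by rewrite /ip big_nil; under eq_fun do rewrite big_nil; exact: tends_cst.
rewrite /ip big_cons; under eq_fun do rewrite big_cons; apply: tendsD => //.
by apply: tendsM => //; exact: tends_star.
Qed.

(** The limit is taken coordinatewise, and the seminorms [sseg] pass to it. *)
Theorem hmod_complete (u : nat -> H) : hcauchy u -> exists l, htends u l.
Proof.
move=> cu.
have /choice [x ux] i : exists l, tends (fun n => hval (u n) i) l.
  apply: cauchy_tends => e e0; have [N HN] := cu _ e0; exists N => m n Nm mn.
  apply: le_lt_trans (HN _ _ Nm mn).
  apply: (le_trans _ (sseg_hn _ (leqnSn i))).
  by apply: (nrm_coord (hval (u n - u m))); rewrite leqnn ltnSn.
(* For fixed p <= q, the seminorm of u n - u m is small for m >= n and tends to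
   that of u n - x as m grows. *)
have xu e : 0 < e -> exists N, forall n, (N <= n)%N ->
    forall p q, (p <= q)%N -> sseg p q (hval (u n) - x) <= e.
  move=> e0; have [N HN] := cu _ e0; exists N => n Nn p q pq.
  rewrite -ler_sqr ?nnegrE ?sn_ge0 ?(ltW e0) // sn_sqr.
  apply: (@tends_nrm_le _ _ (fun m =>
    ip (index_iota p q) (hval (u n - u m)) (hval (u n - u m)))).
    apply: tends_ip => i e' e0'; have [M HM] := ux i _ e0'; exists M => m /HM.
    rewrite nrm_distC; congr (nrm _ < _).
    rewrite -[(hval _ - x) i]/(hval (u n) i - x i).
    by rewrite -[hval (u n - u m) i]/(hval (u n) i - hval (u m) i); zmodule.
  exists n => m nm; rewrite -sn_sqr ler_sqr ?nnegrE ?sn_ge0 ?(ltW e0) //.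
  rewrite (le_trans (sseg_hn (u n - u m) pq)) // hn_distC ltW //; exact: HN.
have hx : HA x.
  apply/HA_tail => e e0; have e2 : 0 < e / 2 by rewrite divr_gt0.
  have [N HN] := xu _ e2; have /HA_tail /(_ _ e2) [M HM] := hvalP (u N).
  exists M => m n Mm mn; have h1 := HN _ (leqnn N) _ _ mn; have h2 := HM _ _ Mm mn.
  have -> : x = hval (u N) + - (hval (u N) - x) by zmodule.
  have := snD (index_iota m n) (u N) (- (hval (u N) - x)).
  rewrite snN; move: h1 h2; rewrite /sseg; lra.
exists (HMod hx) => e e0; have e2 : 0 < e / 2 by rewrite divr_gt0.
have [N HN] := xu _ e2; exists N => n /HN h.
apply: (@le_lt_trans _ _ (e / 2)); last lra.
by apply: hn_le => [|k]; [exact: ltW|exact: h].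
Qed.

Definition delta (i : nat) : cseq A := fun j => if j == i then 1 else 0.

Lemma HA_delta i : HA (delta i).
Proof.
apply/HA_tail => e e0; exists i.+1 => m n im mn.
rewrite (@sseg_eq _ _ _ _ _ 0) ?(le_lt_trans _ e0) // => [|j /andP[mj _]].
  by rewrite /sseg /sn /ip big1 ?nrm0 ?sqrtr0 // => j _; rewrite mulr0.
by rewrite /delta gtn_eqF // (leq_trans im).
Qed.

Definition hdelta i : H := HMod (@HA_delta i).

Definition htr m x : H := \sum_(i < m) (hval x i : A^c) *: hdelta i.

Lemma htrE m x i : hval (htr m x) i = if (i < m)%N then hval x i else 0.
Proof.
have dE (j : nat) : hval ((hval x j : A^c) *: hdelta j) i = if i == j then hval x j else 0.
  rewrite hvalZ /rscale /= /delta; case: eqP => // _; first exact: mul1r.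
  exact: mul0r.
elim: m => [|m IH]; first by rewrite /htr big_ord0.
rewrite /htr big_ord_recr /=.
rewrite -[LHS]/(hval (htr m x) i + hval ((hval x m : A^c) *: hdelta m) i).
rewrite IH dE ltnS [in RHS]leq_eqVlt; have [->|_] := eqVneq i m.
  by rewrite ltnn add0r.
exact: addr0.
Qed.

Lemma htr_near x e : 0 < e -> exists N, forall m, (N <= m)%N ->
  hn (x - htr m x) <= e.
Proof.
move=> e0; have /HA_tail /(_ _ e0) [N0 HN] := hvalP x; exists N0 => N N0N.
apply: hn_le => [|n]; first exact: ltW.
apply: (le_trans (sseg_mono _ (leqnn 0) (leq0n n) (leq_maxl n N))).
rewrite -ler_sqr ?nnegrE ?sn_ge0 ?(ltW e0) //.
apply: (le_trans (sseg_cat _ (leq0n N) (leq_maxr n N))).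
have xE i : hval (x - htr N x) i = hval x i - hval (htr N x) i by [].
have -> : sseg 0 N (x - htr N x) = 0.
  rewrite (@sseg_eq _ _ _ _ _ 0) => [|j /andP[_ jN]]; last by rewrite xE htrE jN subrr.
  by rewrite /sseg /sn /ip big1 ?nrm0 ?sqrtr0 // => j _; rewrite mulr0.
rewrite (@sseg_eq _ _ N _ _ x) => [|j /andP[Nj _]]; last first.
  by rewrite xE htrE ltnNge Nj subr0.
rewrite expr0n add0r ler_sqr ?nnegrE ?sn_ge0 ?(ltW e0) // ltW // HN //.
exact: leq_maxr.
Qed.

End HModule.

(** * Neumann series and automatic continuity *)

Section Geometric.
Context {R : realType}.

Lemma geo_dist (d : nat -> nat -> R) (C : R) :
  (forall m, d m m = 0) -> (forall m n, d m n.+1 <= d m n + d n n.+1) ->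
  (forall n, d n n.+1 <= C * 2^-1 ^+ n) ->
  forall m n, (m <= n)%N -> d m n <= 2 * C * (2^-1 ^+ m - 2^-1 ^+ n).
Proof.
move=> d0 dD dC m; elim=> [|n IH].
  by rewrite leqn0 => /eqP ->; rewrite d0 subrr mulr0.
rewrite leq_eqVlt => /orP[/eqP ->|/IH {}IH]; first by rewrite d0 subrr mulr0.
apply: (le_trans (dD _ _)); have := dC n; rewrite exprS; lra.
Qed.

Lemma geo_small (C e : R) : 0 < e -> exists N, forall n, (N <= n)%N ->
  C * 2^-1 ^+ n < e.
Proof.
move=> e0; pose N := Num.bound (`|C| / e); exists N => n Nn.
have nN : `|C| / e < n%:R.
  apply: (@lt_le_trans _ _ N%:R); last by rewrite ler_nat.
  by rewrite archi_boundP // divr_ge0 // ltW.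
have n2 : (n%:R : R) <= 2 ^+ n by rewrite -natrX ler_nat ltnW // ltn_expl.
have p2 : (0 : R) < 2 ^+ n by rewrite exprn_gt0.
rewrite exprVn ltr_pdivrMr //.
move: nN; rewrite ltr_pdivrMr // => nN.
apply: (le_lt_trans (ler_norm C)); apply: (lt_le_trans nN).
by rewrite mulrC ler_wpM2l // ltW.
Qed.

Lemma half_ge0 n : 0 <= (2^-1 : R) ^+ n.
Proof. by rewrite exprn_ge0 ?invr_ge0. Qed.

Lemma geo_diff_le (C : R) m n : 0 <= C ->
  2 * C * (2^-1 ^+ m - 2^-1 ^+ n) <= 2 * C * 2^-1 ^+ m.
Proof. by move=> C0; have := half_ge0 n; nra. Qed.

End Geometric.

Section Operators.
Context {R : realType} {A : cstarAlgType R}.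
Local Notation H := (hmod A).
Implicit Types (x y z : H) (T Q K : H -> H).

Lemma htends_uniq (u : nat -> H) l m : htends u l -> htends u m -> l = m.
Proof.
move=> ul um; apply/eqP; rewrite -subr_eq0; apply/eqP/hn0_eq0.
apply/ler_addgt0Pr => e e0; rewrite add0r.
have e2 : 0 < e / 2 by rewrite divr_gt0.
have [N1 H1] := ul _ e2; have [N2 H2] := um _ e2.
have h1 := H1 _ (leq_maxl N1 N2); have h2 := H2 _ (leq_maxr N1 N2).
set n := maxn _ _ in h1 h2.
have -> : l - m = (u n - m) - (u n - l) by zmodule.
by rewrite (le_trans (hnB _ _)) //; lra.
Qed.

Lemma htendsD (u v : nat -> H) l m : htends u l -> htends v m ->
  htends (fun n => u n + v n) (l + m).
Proof.
move=> ul vm e e0; have e2 : 0 < e / 2 by rewrite divr_gt0.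
have [N1 H1] := ul _ e2; have [N2 H2] := vm _ e2.
exists (maxn N1 N2) => n; rewrite geq_max => /andP[/H1 h1 /H2 h2].
by rewrite opprD addrACA (le_lt_trans (hnD _ _)) //; lra.
Qed.

Lemma htendsN (u : nat -> H) l : htends u l -> htends (fun n => - u n) (- l).
Proof.
move=> ul e /ul[N HN]; exists N => n /HN.
by rewrite -opprD hnN.
Qed.

Lemma htends_cst (l : H) : htends (fun=> l) l.
Proof. by move=> e e0; exists 0 => n _; rewrite subrr hn0. Qed.

Lemma htends_hn_le (u : nat -> H) l c : htends u l ->
  (forall n, hn (u n) <= c) -> hn l <= c.
Proof.
move=> ul uc; apply/ler_addgt0Pr => e e0; have [N HN] := ul _ e0.
have := HN _ (leqnn N); have := uc N => h2 h1.
have -> : l = u N - (u N - l) by zmodule.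
by rewrite (le_trans (hnB _ _)) //; lra.
Qed.

Lemma hgeo_dist (u : nat -> H) C :
  (forall n, hn (u n.+1 - u n) <= C * 2^-1 ^+ n) ->
  forall m n, (m <= n)%N -> hn (u n - u m) <= 2 * C * (2^-1 ^+ m - 2^-1 ^+ n).
Proof.
move=> uC; apply: (@geo_dist _ (fun m n => hn (u n - u m))) => //.
  by move=> m; rewrite subrr hn0.
move=> m n; apply: le_trans (hnD _ _); rewrite le_eqVlt; apply/orP; left.
by apply/eqP; congr hn; zmodule.
Qed.

Lemma hgeo_tends (u : nat -> H) C :
  (forall n, hn (u n.+1 - u n) <= C * 2^-1 ^+ n) -> exists l, htends u l.
Proof.
move=> uC; apply: hmod_complete => e /(geo_small (2 * C))[N HN].
have C0 : 0 <= C by have := uC 0; rewrite expr0; have := hn_ge0 (u 1 - u 0); lra.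
exists N => m n Nm mn; apply: le_lt_trans (HN _ Nm).
exact: le_trans (hgeo_dist uC mn) (geo_diff_le _ _ C0).
Qed.

Definition bdd T := exists2 c : R, 0 <= c & forall x, hn (T x) <= c * hn x.

Lemma htends_lin T (u : nat -> H) l : linear T -> bdd T -> htends u l ->
  htends (fun n => T (u n)) (T l).
Proof.
move=> lT [c c0 Tc] ul e e0; have c1 : 0 < c + 1 by lra.
have [N HN] := ul _ (divr_gt0 e0 c1); exists N => n /HN h.
rewrite -(linB lT) (le_lt_trans (Tc _)) //.
move: h; rewrite ltr_pdivlMr //; have := hn_ge0 (u n - l); nra.
Qed.

Lemma bdd_comp T K : bdd T -> bdd K -> bdd (fun x => T (K x)).
Proof.
move=> [c c0 Tc] [d d0 Kd]; exists (c * d); first exact: mulr_ge0.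
by move=> x; rewrite (le_trans (Tc _)) // -mulrA ler_wpM2l.
Qed.

Lemma bddB T K : bdd T -> bdd K -> bdd (fun x => T x - K x).
Proof.
move=> [c c0 Tc] [d d0 Kd]; exists (c + d); first exact: addr_ge0.
by move=> x; rewrite (le_trans (hnB _ _)) // mulrDl lerD.
Qed.

Lemma bdd_id : bdd id.
Proof. by exists 1 => // x; rewrite mul1r. Qed.

(** The solution of x + K x = y is the limit of the iteration
    u |-> y - K u. *)
Theorem neumann K : linear K -> (forall x, hn (K x) <= 2^-1 * hn x) ->
  exists V : H -> H, [/\ linear V, bdd V, forall y, V y + K (V y) = y
    & forall x, V (x + K x) = x].
Proof.
move=> lK K2; have bK : bdd K by exists 2^-1 => //; rewrite invr_ge0.
have inj x : x + K x = 0 -> x = 0.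
  move=> /eqP; rewrite addr_eq0 => /eqP e; apply: hn0_eq0.
  by have := K2 x; rewrite -hnN -e; have := hn_ge0 x; lra.
have /choice [V VP] y : exists x, x + K x = y.
  pose u := fix u n : H := if n is m.+1 then y - K (u m) else 0.
  have uS m : u m.+1 = y - K (u m) by [].
  have [|l ul] := @hgeo_tends u (hn y).
    elim=> [|n IH]; first by rewrite /= (lin0 lK) !subr0 expr0 mulr1.
    have -> : u n.+2 - u n.+1 = - K (u n.+1 - u n).
      by rewrite (linB lK) uS [X in _ - X = _]uS; zmodule.
    rewrite hnN (le_trans (K2 _)) // exprS mulrCA ler_wpM2l ?invr_ge0 //.
  exists l; have h : htends (fun n => u n.+1) l.
    by move=> e /ul[N HN]; exists N => n Nn; apply: HN; apply: leqW.
  have := htendsD (htends_cst y) (htendsN (htends_lin lK bK ul)).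
  by move=> /(htends_uniq h) {1}->; rewrite subrK.
have lV : linear V.
  move=> a x y; apply/eqP; rewrite -subr_eq0; apply/eqP/inj.
  rewrite (linB lK) (linD lK) (linZ lK).
  rewrite [LHS](_ : _ = (V (a *: x + y) + K (V (a *: x + y))) -
     (a *: V x + a *: K (V x) + (V y + K (V y)))); last by zmodule.
  by rewrite -scalerDr !VP subrr.
exists V; split=> //.
  exists 2 => // y; have := K2 (V y); have := hnB (V y + K (V y)) (K (V y)).
  rewrite addrK VP; have := hn_ge0 y; lra.
move=> x; apply/eqP; rewrite -subr_eq0; apply/eqP/inj.
rewrite (linB lK) [LHS](_ : _ = (V (x + K x) + K (V (x + K x))) -
     (x + K x)); last by zmodule.
by rewrite VP subrr.
Qed.

(** Zabreiko's form of the open mapping principle.  P t x stands for a bound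
    by t on some countably subadditive seminorm p of x, such as the norm of
    a projection of x or an infimum of norms of preimages; a relation avoids
    computing the infimum.  By completeness some set p <= n is dense in a ball,
    and the geometric approximation of x by such elements, together with
    countable subadditivity, bounds p by a multiple of the norm. *)
Theorem zabreiko (P : R -> H -> Prop) :
  (forall s t x, s <= t -> P s x -> P t x) ->
  (forall x, exists t, P t x) ->
  (forall s t x y, P s x -> P t y -> P (s + t) (x - y)) ->
  (forall s t x, 0 <= t -> P s x -> P (t * s) (hr t x)) ->
  (forall (u : nat -> H) x D, u 0 = 0 -> htends u x ->
     (forall n, P (D * 2^-1 ^+ n) (u n.+1 - u n)) -> P (2 * D) x) ->
  exists2 C : R, 0 <= C & forall x d, 0 < d -> hn x <= d -> P (C * d) x.
Proof.
move=> Pmono Ptot PB PZ Pcvg.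
have [n [x0 [r [r0 Hr]]]] : exists n x0 r, 0 < r /\ forall x, hn (x - x0) < r ->
    forall e, 0 < e -> exists2 y, P n%:R y & hn (x - y) < e.
  apply: contrapT => noball.
  (* Otherwise every ball contains a point some neighbourhood of which avoids
     P n; nested balls of this kind, taken for every n, shrink to a point that
     lies in no P n. *)
  have /choice [f fP] (s : nat * H * R) : exists w : H * R, 0 < s.2 ->
      [/\ hn (w.1 - s.1.2) < s.2, 0 < w.2 &
       forall y, P s.1.1%:R y -> w.2 <= hn (w.1 - y)].
    case: s => [[n x0] r] /=.
    have [r0|] := ltP 0 r; last by exists (x0, 0).
    apply: contrapT => H2; apply: noball; exists n, x0, r; split=> // x xr e e0.
    apply: contrapT => H3; apply: H2; exists (x, e) => _; split=> //= y Py.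
    by rewrite leNgt; apply/negP => ye; apply: H3; exists y.
  pose st := fix st n : H * R := if n is m.+1 then
     let w := f (m, (st m).1, (st m).2 / 2) in
     (w.1, Num.min ((st m).2 / 2) (w.2 / 2)) else (0, 1).
  pose x n := (st n).1; pose r n := (st n).2.
  pose ep n := (f (n, x n, r n / 2)).2.
  have r_gt0 n : 0 < r n.
    elim: n => [|n IH]; first exact: ltr01.
    have h : 0 < r n / 2 by rewrite divr_gt0.
    have [_ e0 _] := fP (n, x n, r n / 2) h.
    by rewrite /r /= lt_min h divr_gt0.
  have rS n : r n.+1 <= r n / 2 by rewrite {1}/r /= ge_min lexx.
  have re n : r n.+1 <= ep n / 2 by rewrite {1}/r /= ge_min lexx orbT.
  have h n : 0 < r n / 2 by rewrite divr_gt0.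
  have xS n : hn (x n.+1 - x n) < r n / 2.
    by have [] := fP (n, x n, r n / 2) (h n).
  have xd n k : hn (x (n + k)%N - x n) <= r n - r (n + k)%N.
    elim: k => [|k IH]; first by rewrite addn0 !subrr hn0.
    rewrite addnS; have := xS (n + k)%N; have := rS (n + k)%N.
    have := hnD (x (n + k).+1 - x (n + k)%N) (x (n + k)%N - x n).
    have -> : x (n + k).+1 - x (n + k)%N + (x (n + k)%N - x n) =
       x (n + k).+1 - x n by zmodule.
    lra.
  have r2 n : r n <= 2^-1 ^+ n.
    elim: n => [|n IH]; first by rewrite expr0.
    by have := rS n; rewrite exprS; lra.
  have [|l xl] := @hgeo_tends x 1.
    by move=> n; have := xS n; have := r2 n; have := r_gt0 n; lra.
  have lx n : hn (l - x n) <= r n.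
    apply/ler_addgt0Pr => e e0; have [N HN] := xl _ e0.
    have h1 := HN _ (leq_addl n N); have h2 := xd n N.
    have h3 := r_gt0 (n + N)%N.
    have -> : l - x n = (x (n + N)%N - x n) - (x (n + N)%N - l) by zmodule.
    by rewrite (le_trans (hnB _ _)) //; lra.
  have [t Pt] := Ptot l; pose n := Num.bound `|t|.
  have tn : t <= n%:R by rewrite (le_trans (ler_norm _)) // ltW // /n archi_boundP.
  have [_ e0 far] := fP (n, x n, r n / 2) (h n).
  have := far _ (Pmono _ _ _ tn Pt); rewrite leNgt => /negP; apply.
  rewrite -[_.1]/(x n.+1) -[_.2]/(ep n) hn_distC.
  by have := lx n.+1; have := re n; rewrite -/(ep n) in e0; lra.
have dense0 x : hn x < r -> forall e, 0 < e -> exists2 y, P (2 * n%:R) y & hn (x - y) < e.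
  move=> xr e e0; have e2 : 0 < e / 2 by rewrite divr_gt0.
  have [||y1 Py1 h1] := Hr (x0 + x) _ (e / 2) => //; first by rewrite addrC addKr.
  have [||y2 Py2 h2] := Hr x0 _ (e / 2) => //; first by rewrite subrr hn0.
  exists (y1 - y2); first by rewrite mulr_natl mulr2n; exact: PB.
  have -> : x - (y1 - y2) = (x0 + x - y1) - (x0 - y2) by zmodule.
  by rewrite (le_lt_trans (hnB _ _)) //; lra.
(* A point of norm at most d is scaled into the ball of radius r, approximated
   there within r / 4, and scaled back. *)
pose K := 4 * n%:R / r.
have K0 : 0 <= K by rewrite divr_ge0 ?mulr_ge0 // ltW.
have /choice [g gP] (s : R * H) : exists y, 0 < s.1 -> hn s.2 <= s.1 ->
    P (K * s.1) y /\ hn (s.2 - y) <= s.1 / 2.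
  case: s => d x /=; have [d0|] := ltP 0 d; last by exists 0.
  have [xd|] := leP (hn x) d; last by exists 0.
  have t0 : 0 < r / (2 * d) by rewrite divr_gt0 // mulr_gt0.
  have s0 : 0 < 2 * d / r by rewrite divr_gt0 // mulr_gt0.
  have st : 2 * d / r * (r / (2 * d)) = 1 by field; rewrite !gt_eqF.
  have [||y Py yx] := @dense0 (hr (r / (2 * d)) x) _ (r / 4).
  - apply: (le_lt_trans (hn_hr _ (ltW t0))).
    have -> : r / (2 * d) * hn x = (r / 2) * (hn x / d) by field; rewrite gt_eqF.
    have : hn x / d <= 1 by rewrite ler_pdivrMr // mul1r.
    have : 0 <= hn x / d by rewrite divr_ge0 ?hn_ge0 // ltW.
    nra.
  - by rewrite divr_gt0.
  exists (hr (2 * d / r) y) => _ _; split.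
    have -> : K * d = 2 * d / r * (2 * n%:R) by rewrite /K; field; rewrite gt_eqF.
    by apply: PZ => //; exact: ltW.
  have -> : x - hr (2 * d / r) y = hr (2 * d / r) (hr (r / (2 * d)) x - y).
    by rewrite hrBr hrA st hr1.
  apply: (le_trans (hn_hr _ (ltW s0))).
  have -> : d / 2 = 2 * d / r * (r / 4) by field; rewrite gt_eqF.
  by rewrite ler_wpM2l // ltW.
exists (2 * K) => [|x d d0 xd]; first by rewrite mulr_ge0.
pose u := fix u n : H := if n is m.+1 then u m + g (d * 2^-1 ^+ m, x - u m) else 0.
have dp m : 0 < d * 2^-1 ^+ m by rewrite mulr_gt0 // exprn_gt0 // invr_gt0.
have ux m : hn (x - u m) <= d * 2^-1 ^+ m.
  elim: m => [|m IH]; first by rewrite subr0 expr0 mulr1.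
  have [_] := gP (d * 2^-1 ^+ m, x - u m) (dp m) IH.
  have -> : x - u m.+1 = x - u m - g (d * 2^-1 ^+ m, x - u m) by rewrite /=; zmodule.
  by rewrite exprS /=; lra.
rewrite -mulrA; apply: (Pcvg u) => // [e e0|m].
  have [N HN] := geo_small d e0; exists N => m /HN; apply: le_lt_trans.
  by rewrite hn_distC.
have [+ _] := gP (d * 2^-1 ^+ m, x - u m) (dp m) (ux m).
by rewrite /= mulrA [u m + _]addrC addrK.
Qed.

End Operators.

(** * Complemented submodules *)

Section Complements.
Context {R : realType} {A : cstarAlgType R}.
Local Notation H := (hmod A).
Implicit Types (x y z : H) (T Q K : H -> H).

Definition hclosed (M : H -> Prop) :=
  forall u l, htends u l -> (forall n, M (u n)) -> M l.

Lemma hr_lin T t x : linear T -> T (hr t x) = hr t (T x).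
Proof. by move=> lT; exact: linZ. Qed.

(** The seminorm x |-> |Q x| is countably subadditive because M and N are
    closed and meet only in 0. *)
Theorem bdd_projection (M N : H -> Prop) Q : linear Q ->
  (forall x y, M x -> M y -> M (x - y)) ->
  (forall x y, N x -> N y -> N (x - y)) ->
  hclosed M -> hclosed N ->
  (forall x, M x -> N x -> x = 0) ->
  (forall x, N (Q x)) -> (forall x, M (x - Q x)) -> bdd Q.
Proof.
move=> lQ MB NB cM cN MN NQ MQ.
have [||||u x D u0 ux uD|C C0 HC] := @zabreiko _ _ (fun t x => hn (Q x) <= t).
- by move=> s t x st /le_trans; apply.
- by move=> x; exists (hn (Q x)).
- move=> s t x y xs yt; rewrite (linB lQ) (le_trans (hnB _ _)) // lerD //.
- move=> s t x t0 xs; rewrite hr_lin // (le_trans (hn_hr _ t0)) // ler_wpM2l //.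
- have uD' n : hn (Q (u n.+1) - Q (u n)) <= D * 2^-1 ^+ n by rewrite -(linB lQ).
  have [z Qz] := hgeo_tends uD'.
  have Nz : N z by apply: (cN _ _ Qz).
  have Mz : M (x - z) by apply: (cM _ _ (htendsD ux (htendsN Qz))).
  have -> : Q x = z.
    apply/eqP; rewrite -subr_eq0; apply/eqP/MN; last exact: NB.
    by have := MB _ _ Mz (MQ x); congr M; zmodule.
  have D0 : 0 <= D by have := uD 0; rewrite expr0; have := hn_ge0 (Q (u 1 - u 0)); lra.
  apply: (htends_hn_le Qz) => n; have := hgeo_dist uD' (leq0n n).
  by rewrite u0 (lin0 lQ) subr0 expr0; have := @half_ge0 R n; nra.
exists C => // x; have [x0|] := ltP 0 (hn x); first exact: HC.
by move=> /hn0_eq0 ->; rewrite (lin0 lQ) hn0 mulr0.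
Qed.

Lemma tends_geo (u : nat -> A) C :
  (forall n, nrm (u n.+1 - u n) <= C * 2^-1 ^+ n) ->
  exists2 l, tends u l & nrm (l - u 0) <= 2 * C.
Proof.
move=> uC.
have C0 : 0 <= C by have := uC 0; rewrite expr0; have := nrm_ge0 (u 1 - u 0); lra.
have d := @geo_dist _ (fun m n => nrm (u n - u m)) C.
have {}d m n : (m <= n)%N -> nrm (u n - u m) <= 2 * C * 2^-1 ^+ m.
  move=> mn; apply: le_trans (geo_diff_le m n C0); apply: d => // [k|k l].
    by rewrite subrr nrm0.
  by apply: le_trans (nrmD _ _); rewrite le_eqVlt; apply/orP; left;
    apply/eqP; congr nrm; zmodule.
have [|l ul] := @cauchy_tends _ _ u.
  move=> e /(geo_small (2 * C))[N HN]; exists N => m n Nm mn.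
  exact: le_lt_trans (d _ _ mn) (HN _ Nm).
exists l => //.
have h : tends (fun n => u n - u 0) (l - u 0).
  by apply: tendsD => //; exact: tends_cst.
apply: (tends_nrm_le h); exists 0 => n _.
by have := d 0 n (leq0n n); rewrite expr0 mulr1.
Qed.

Lemma htends_scale x (u : nat -> A) (c : A) :
  tends u c -> htends (fun k => (u k : A^c) *: x) ((c : A^c) *: x).
Proof.
move=> uc e e0; have x1 : 0 < hn x + 1 by have := hn_ge0 x; lra.
have [N HN] := uc _ (divr_gt0 e0 x1); exists N => n /HN h.
rewrite -scalerBl (le_lt_trans (hnZ _ _)) //.
move: h; rewrite ltr_pdivlMr //.
by have := nrm_ge0 (u n - c); rewrite -/(nrm (u n - c)); nra.
Qed.

Lemma htends_comb n (e : 'I_n -> H) (u : nat -> 'I_n -> A) (c : 'I_n -> A) :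
  (forall i, tends (u^~ i) (c i)) ->
  htends (fun k => \sum_(i < n) (u k i : A^c) *: e i)
         (\sum_(i < n) (c i : A^c) *: e i).
Proof.
move=> uc; elim: n e u c uc => [|n IH] e u c uc.
  by rewrite big_ord0; under eq_fun do rewrite big_ord0; exact: htends_cst.
rewrite big_ord_recl; under eq_fun do rewrite big_ord_recl.
apply: htendsD; first exact: htends_scale.
exact: (IH (fun i => e (lift ord0 i)) (fun k i => u k (lift ord0 i))
  (fun i => c (lift ord0 i))).
Qed.

(** The open mapping theorem for the surjection of A^n onto the image of Q
    given by the generators. *)
Theorem fg_open Q n (e : 'I_n -> H) : linear Q -> bdd Q ->
  (forall x, exists c : 'I_n -> A^c, Q x = \sum_(i < n) c i *: e i) ->
  exists2 C : R, 0 <= C & forall x d, 0 < d -> hn x <= d ->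
    exists2 c : 'I_n -> A^c, Q x = \sum_(i < n) c i *: e i &
      forall i, nrm (c i : A) <= C * d.
Proof.
move=> lQ bQ span.
apply: (@zabreiko _ _ (fun t x => exists2 c : 'I_n -> A^c,
  Q x = \sum_(i < n) c i *: e i & forall i, nrm (c i : A) <= t)).
- by move=> s t x st [c ce cs]; exists c => // i; exact: le_trans (cs i) st.
- move=> x; have [c ce] := span x; exists (\sum_(i < n) nrm (c i : A)), c => // i.
  by rewrite (bigD1 i) //= lerDl sumr_ge0 // => j _; exact: nrm_ge0.
- move=> s t x y [c ce cs] [d de ds]; exists (fun i => c i - d i).
    rewrite (linB lQ) ce de -sumrB; apply: eq_bigr => i _.
    by rewrite scalerBl.
  by move=> i; rewrite (le_trans (nrmB _ _)) // lerD.
- move=> s t x t0 [c ce cs]; exists (fun i => (rsc t 1 : A^c) * c i).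
    by rewrite hr_lin // ce /hr scaler_sumr; apply: eq_bigr => i _; rewrite scalerA.
  move=> i; apply: (le_trans (nrmM (c i : A) (rsc t 1))).
  rewrite mulrC ler_pM ?nrm_ge0 //; exact: nrm_rsc1.
move=> u x D u0 ux uD.
have /choice [c cP] k : exists c : 'I_n -> A^c,
    Q (u k.+1 - u k) = \sum_(i < n) c i *: e i /\
    forall i, nrm (c i : A) <= D * 2^-1 ^+ k.
  by have [c] := uD k; exists c.
pose s k i : A := \sum_(j < k) (c j i : A).
have sS k i : s k.+1 i - s k i = c k i.
  by rewrite /s big_ord_recr addrC; exact: addKr.
have s0 i : s 0 i = 0 by rewrite /s big_ord0.
have /choice [l lP] i : exists l, tends (s^~ i) l /\ nrm l <= 2 * D.
  have [|l ? ] := @tends_geo (s^~ i) D.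
    by move=> k; rewrite sS; have [_] := cP k.
  by rewrite s0 subr0; exists l.
exists l => [|i]; last by have [] := lP i.
have Qu k : Q (u k) = \sum_(i < n) (s k i : A^c) *: e i.
  elim: k => [|k IH].
    by rewrite u0 (lin0 lQ) big1 // => i _; rewrite s0 scale0r.
  have -> : u k.+1 = (u k.+1 - u k) + u k by rewrite subrK.
  rewrite (linD lQ) IH; have [-> _] := cP k; rewrite -big_split.
  by apply: eq_bigr => i _; rewrite /= -scalerDl -(sS k i) subrK.
apply: (htends_uniq (htends_lin lQ bQ ux)).
under eq_fun do rewrite Qu.
by apply: htends_comb => i; have [] := lP i.
Qed.

Lemma htr_linear m : linear (@htr R A m).
Proof.
move=> a x y; rewrite /htr scaler_sumr -big_split; apply: eq_bigr => i _.
rewrite /= scalerA -scalerDl; congr (_ *: _).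
Qed.

(** For m large, x |-> Q (x truncated to A^m) is close to the identity on each
    generator, hence, by [fg_open], on all of the image of Q.  Inverting it
    expresses every x of the image by its first m coordinates. *)
Theorem dual_basis Q n (e : 'I_n -> H) : linear Q -> bdd Q ->
  (forall x, Q (Q x) = Q x) ->
  (forall x, exists c : 'I_n -> A^c, Q x = \sum_(i < n) c i *: e i) ->
  exists m (r : 'I_m -> H), (forall i, Q (r i) = r i) /\
    forall x, Q x = x -> x = \sum_(i < m) (hval x i : A^c) *: r i.
Proof.
move=> lQ bQ QQ span; have [C C0 HC] := fg_open lQ bQ span.
have [q q0 Qq] := bQ.
(* With n generators, coefficients bounded by C d and |Q| <= q, an error eta on
   each generator makes |K x| at most d / 2. *)
pose eta : R := (2 * (n%:R + 1) * (C + 1) * (q + 1))^-1.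
have n1 : (0 : R) < n%:R + 1 by rewrite ltr_wpDl.
have C1 : 0 < C + 1 by lra.
have q1 : 0 < q + 1 by lra.
have eta0 : 0 < eta by rewrite invr_gt0 !mulr_gt0.
have /choice [N HN] i : exists N, forall m, (N <= m)%N -> hn (e i - htr m (e i)) <= eta.
  exact: htr_near.
pose m := \max_(i < n) N i.
have Hm i : hn (e i - htr m (e i)) <= eta by apply: HN; exact: leq_bigmax.
pose K x := Q (htr m (Q x)) - Q x.
have lK : linear K.
  by move=> a x y; rewrite /K !(lQ, htr_linear) scalerBr; zmodule.
have K2 x : hn (K x) <= 2^-1 * hn x.
  have Kd d : 0 < d -> hn x <= d -> hn (K x) <= 2^-1 * d.
    move=> d0 xd; have [c ce cd] := HC x d d0 xd.
    have -> : K x = \sum_(i < n) c i *: Q (htr m (e i) - e i).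
      rewrite /K -[X in _ - X = _]QQ -(linB lQ) ce (lin_sum (htr_linear m)) -sumrB.
      rewrite (lin_sum lQ); apply: eq_bigr => i _.
      by rewrite (linZ (htr_linear m)) -scalerBr (linZ lQ).
    apply: (le_trans (hn_sum _ _ _)).
    apply: (@le_trans _ _ (\sum_(i < n) (q * eta * (C * d)))).
      apply: ler_sum => i _; apply: (le_trans (hnZ _ _)).
      apply: ler_pM; rewrite ?hn_ge0 ?nrm_ge0 //.
      by apply: (le_trans (Qq _)); rewrite ler_wpM2l // hn_distC.
    rewrite sumr_const card_ord -[_ *+ n]mulr_natl.
    have -> : n%:R * (q * eta * (C * d)) =
      (n%:R / (n%:R + 1)) * (q / (q + 1)) * (C / (C + 1)) * (2^-1 * d).
      by rewrite /eta; field; rewrite !gt_eqF.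
    have fr (t : R) : 0 <= t -> 0 <= t / (t + 1) <= 1.
      by move=> t0; rewrite divr_ge0 ?ler_pdivrMr /=; lra.
    have /andP[a0 a1] := fr n%:R (ler0n _ _).
    have /andP[b0 b1] := fr q q0; have /andP[c0 c1] := fr C C0.
    rewrite ler_piMl ?mulr_ge0 ?invr_ge0 ?(ltW d0) //.
    exact: mulr_ile1 (mulr_ge0 a0 b0) c0 (mulr_ile1 a0 b0 a1 b1) c1.
  have [x0|/hn0_eq0 ->] := ltP 0 (hn x); first exact: Kd.
  by rewrite (lin0 lK) hn0 mulr0.
have [V [lV _ KV VK]] := neumann lK K2.
have QK x : Q (K x) = K x by rewrite /K (linB lQ) !QQ.
have KQ x : K (Q x) = K x by rewrite /K !QQ.
(* K maps into the image of Q and factors through Q, so V commutes with Q. *)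
have QV y : Q (V y) = V (Q y).
  by rewrite -{2}(KV y) (linD lQ) QK -KQ VK.
exists m, (fun i => V (Q (hdelta i))); split.
  by move=> i; rewrite QV QQ.
move=> x Qx; have {1}<- : V (Q (htr m x)) = x.
  by rewrite -[RHS](VK x) /K Qx; congr V; zmodule.
rewrite /htr (lin_sum lQ) (lin_sum lV); apply: eq_bigr => i _.
by rewrite (linZ lQ) (linZ lV).
Qed.

End Complements.

(** * Decompositions as bounded outer inverses *)

Section Bridge.
Context {R : realType} {A : cstarAlgType R}.
Local Notation H := (hmod A).
Implicit Types (x y z : H) (F : Ba A) (G : H -> H) (M N : set (cseq A)).

Definition Ba_hmod F x : H := HMod (@Ba_HA _ _ F _ (hvalP x)).

Lemma Ba_hmod_lin F : linear (Ba_hmod F).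
Proof.
move=> a x y; apply: hval_inj; have [FD FZ] := Ba_linear F.
rewrite -[LHS]/(F (rscale (hval x) a + hval y)) FD; [|exact: HAZ (hvalP x)|exact: hvalP].
by rewrite FZ //; exact: hvalP.
Qed.

Lemma Ba_hmod_bdd F : bdd (Ba_hmod F).
Proof.
have [c Hc] := Ba_bounded F; exists `|c| => // x.
apply: (le_trans (Hc _ (hvalP x))); rewrite ler_wpM2r ?ler_norm //.
exact: hn_ge0.
Qed.

Definition hset (P : H -> Prop) : set (cseq A) :=
  [set x | exists2 y : H, P y & hval y = x].

Lemma hset_hval P x : hset P (hval x) <-> P x.
Proof.
by split=> [[y Py /hval_inj <- //]|Px]; exists x.
Qed.

Lemma hset_HA P : hset P `<=` HA.
Proof. by move=> _ [y _ <-]; exact: hvalP. Qed.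

Lemma closed_submodule_equalizer (T K : H -> H) : linear T -> linear K ->
  bdd T -> bdd K -> closed_submodule (hset (fun x => T x = K x)).
Proof.
move=> lT lK bT bK; split.
- exact: hset_HA.
- by exists 0 => //; rewrite (lin0 lT) (lin0 lK).
- move=> _ _ [x Tx <-] [y Ty <-]; exists (x + y) => //.
  by rewrite (linD lT) (linD lK) Tx Ty.
- move=> _ a [x Tx <-]; exists ((a : A^c) *: x) => //.
  by rewrite (linZ lT) (linZ lK) Tx.
move=> x hx near; exists (HMod hx) => //.
set z := HMod hx; have bTK := bddB bT bK; have [c c0 Hc] := bTK.
apply/eqP; rewrite -subr_eq0; apply/eqP/hn0_eq0/ler_addgt0Pr => e e0.
rewrite add0r; have c1 : 0 < c + 1 by lra.
have [_ [y Ty <-] xy] := near _ (divr_gt0 e0 c1).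
have -> : T z - K z = T (z - y) - K (z - y).
  by rewrite (linB lT) (linB lK) Ty; zmodule.
apply: (le_trans (Hc _)); have h : hn (z - y) < e / (c + 1) by [].
move: h; rewrite ltr_pdivlMr //; have := hn_ge0 (z - y); nra.
Qed.

Lemma closed_hclosed M : closed_submodule M -> hclosed (fun x : H => M (hval x)).
Proof.
move=> [_ _ _ _ cM] u l ul Mu; apply: (cM _ (hvalP l)) => e e0.
have [n Hn] := ul _ e0; exists (hval (u n)); first exact: Mu.
by have := Hn n (leqnn n); rewrite hn_distC.
Qed.

Lemma closed_subB M x y : closed_submodule M -> M (hval x) -> M (hval y) ->
  M (hval (x - y)).
Proof.
move=> [_ _ MD MZ _] Mx My; rewrite hvalB; apply: MD => //.
have -> : - hval y = rscale (hval y) (- 1).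
  by apply/funext => i; rewrite /rscale mulrN1.
exact: MZ.
Qed.

(** G inverts F on M2 and vanishes on N2.  It is bounded because F is bounded
    below on M1 and the projection onto M2 is bounded. *)
Theorem decomposition_outer F M1 N1 M2 N2 :
  MPhi_decomposition F M1 N1 M2 N2 ->
  exists G, [/\ outer_inverse (Ba_hmod F) G, bdd G,
    forall x, N1 (hval x) <-> G (Ba_hmod F x) = 0 &
    forall y, N2 (hval y) <-> G y = 0].
Proof.
move=> [[c1 d1 c2 d2] [S1 I1] [S2 I2] [FM FN] [[Ffun Finj Fsurj] [c Fc]]].
have sub1 : M1 `<=` HA by case: c1.
have Mlin : forall (M : set (cseq A)) (a : A^c) x y, closed_submodule M ->
    M (hval x) -> M (hval y) -> M (hval (a *: x + y)).
  by move=> M a x y [_ _ MD MZ _] Mx My; apply: MD => //; exact: MZ.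
have disj2 y : M2 (hval y) -> N2 (hval y) -> y = 0.
  move=> My Ny; have : (M2 `&` N2) (hval y) by [].
  by rewrite I2 => /= e; apply: hval_inj.
have /choice [G GP] y : exists x : H, M1 (hval x) /\ N2 (hval (y - Ba_hmod F x)).
  have : HA (hval y) by exact: hvalP.
  rewrite S2 => -[m [n [Mm Nn e]]].
  have [x Mx Fx] := Fsurj _ Mm; exists (HMod (sub1 _ Mx)); split=> //.
  have -> : hval (y - Ba_hmod F (HMod (sub1 _ Mx))) = n; last by [].
  by rewrite hvalB e -[hval (Ba_hmod F _)]/(F x) Fx; zmodule.
have FhM1 x : M1 (hval x) -> M2 (hval (Ba_hmod F x)) by move=> Mx; apply: Ffun.
(* The two conditions of GP determine G y. *)
have Guniq y x : M1 (hval x) -> N2 (hval (y - Ba_hmod F x)) -> G y = x.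
  move=> Mx Nx; have [Mg Ng] := GP y.
  have e : Ba_hmod F (G y) = Ba_hmod F x.
    apply/eqP; rewrite -subr_eq0; apply/eqP/disj2.
      by apply: (closed_subB c2); exact: FhM1.
    have := closed_subB d2 Nx Ng; congr (N2 (hval _)); zmodule.
  apply: hval_inj; apply: Finj; rewrite ?inE //.
  by have := congr1 (@hval _ _) e.
have lF := Ba_hmod_lin F.
have lG : linear G.
  move=> a x y; apply: Guniq.
    by apply: Mlin => //; [have [] := GP x|have [] := GP y].
  have [_ Nx] := GP x; have [_ Ny] := GP y.
  have := Mlin _ a _ _ d2 Nx Ny; congr (N2 (hval _)).
  by rewrite lF scalerBr; zmodule.
have N20 : N2 (hval 0) by case: d2.
have M10 : M1 (hval 0) by case: c1.
have GFG y : G (Ba_hmod F (G y)) = G y.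
  by apply: Guniq; [have [] := GP y|rewrite subrr].
have oG : outer_inverse (Ba_hmod F) G by [].
have N2G y : N2 (hval y) <-> G y = 0.
  split=> [Ny|Gy]; first by apply: Guniq => //; rewrite (lin0 lF) subr0.
  by have [_] := GP y; rewrite Gy (lin0 lF) subr0.
exists G; split=> //.
- have [C C0 HC] : bdd (fun y => Ba_hmod F (G y)).
    apply: (@bdd_projection _ _ (fun y => N2 (hval y)) (fun y => M2 (hval y))).
    + exact: comp_lin.
    + by move=> x y; exact: closed_subB.
    + by move=> x y; exact: closed_subB.
    + exact: closed_hclosed.
    + exact: closed_hclosed.
    + by move=> x Nx Mx; exact: disj2.
    + by move=> y; apply: FhM1; have [] := GP y.
    + by move=> y; have [] := GP y.
  exists (`|c| * C) => [|y]; first by rewrite mulr_ge0.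
  have [Mg _] := GP y; apply: (le_trans (Fc _ Mg)).
  rewrite -mulrA; apply: (@le_trans _ _ (`|c| * hn (Ba_hmod F (G y)))).
    by apply: ler_wpM2r; [exact: sqrtr_ge0|exact: ler_norm].
  by rewrite ler_wpM2l.
- move=> x; split=> [Nx|Gx].
    by apply/N2G; apply: FN; exists (hval x).
  have : HA (hval x) by exact: hvalP.
  have subN1 : N1 `<=` HA by case: d1.
  rewrite S1 => -[m [n [Mm Nn e]]].
  pose m' : H := HMod (sub1 _ Mm); pose n' : H := HMod (subN1 _ Nn).
  have xE : x = m' + n' by apply: hval_inj.
  have Fn : N2 (hval (Ba_hmod F n')) by apply: FN; exists n.
  have : G (Ba_hmod F x) = m'.
    by apply: Guniq => //; rewrite xE (linD lF) addrC addKr.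
  by rewrite Gx => m0; rewrite xE -m0 add0r.
Qed.

Theorem outer_decomposition F G : outer_inverse (Ba_hmod F) G -> bdd G ->
  MPhi_decomposition F
    (hset (fun x => G (Ba_hmod F x) = x)) (hset (fun x => G (Ba_hmod F x) = 0))
    (hset (fun y => Ba_hmod F (G y) = y)) (hset (fun y => G y = 0)).
Proof.
move=> oG bG; have [lG GFG] := oG; have lF := Ba_hmod_lin F; have bF := Ba_hmod_bdd F.
have l0 : linear (fun _ : H => 0 : H) by move=> a x y; rewrite scaler0 addr0.
have lid : linear (@id H) by [].
have b0 : bdd (fun _ : H => 0 : H) by exists 0 => // x; rewrite hn0 mul0r.
have lGF := comp_lin lF lG; have lFG := comp_lin lG lF.
have bGF := bdd_comp bG bF; have bFG := bdd_comp bF bG.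
split.
- by split; apply: closed_submodule_equalizer => //; exact: bdd_id.
- split.
    apply/seteqP; split=> [x hx|x [_ [_ [[y _ <-] [z _ <-] ->]]]]; last first.
      by apply: HAD; exact: hvalP.
    pose z : H := HMod hx.
    exists (hval (G (Ba_hmod F z))), (hval (z - G (Ba_hmod F z))); split.
    + by apply/hset_hval; rewrite GFG.
    + by apply/hset_hval; rewrite (linB lF) (linB lG) GFG subrr.
    + by rewrite -hvalD addrC subrK.
  apply/seteqP; split=> [x [[y Gy <-] [z Gz /hval_inj zy]]|_ ->].
    by rewrite zy in Gz *; rewrite -Gy Gz.
  by split; exists 0; rewrite // (lin0 lGF).
- split.
    apply/seteqP; split=> [x hx|x [_ [_ [[y _ <-] [z _ <-] ->]]]]; last first.
      by apply: HAD; exact: hvalP.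
    pose z : H := HMod hx.
    exists (hval (Ba_hmod F (G z))), (hval (z - Ba_hmod F (G z))); split.
    + by apply/hset_hval; rewrite GFG.
    + by apply/hset_hval; rewrite (linB lG) GFG subrr.
    + by rewrite -hvalD addrC subrK.
  apply/seteqP; split=> [x [[y Gy <-] [z Gz /hval_inj zy]]|_ ->].
    by rewrite zy in Gz *; rewrite -Gy Gz (lin0 lF).
  by split; exists 0; rewrite // ?(lin0 lFG) ?(lin0 lG).
- split=> _ [_ [x Gx <-] <-]; apply/(hset_hval _ (Ba_hmod F x)); first by rewrite Gx.
  by rewrite Gx.
split.
  split.
  - by move=> _ [x Gx <-]; apply/(hset_hval _ (Ba_hmod F x)); rewrite Gx.
  - move=> _ _ /set_mem[x Gx <-] /set_mem[y Gy <-] e.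
    by congr hval; rewrite -Gx -Gy; congr G; apply: hval_inj.
  - move=> _ [y Gy <-]; exists (hval (G y)).
      by apply/hset_hval; rewrite GFG.
    by rewrite -[LHS]/(hval (Ba_hmod F (G y))) Gy.
have [c c0 Hc] := bG; exists c => _ [x Gx <-].
by rewrite -{1}Gx; exact: Hc.
Qed.

Lemma fin_genP N (P : H -> Prop) : N `<=` HA -> (forall x, N (hval x) <-> P x) ->
  fin_gen N <-> fg_pred P.
Proof.
move=> NH NP.
have E n (e : 'I_n -> H) (c : 'I_n -> A) :
    hval (\sum_(i < n) (c i : A^c) *: e i) = \sum_(i < n) rscale (hval (e i)) (c i).
  by rewrite hval_sum.
split=> [[n [e Ne]]|[n [e Pe]]].
  (* Each generator lies in N, being the combination with Kronecker
     coefficients, hence it lies in H_A. *)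
  have eN i : N (e i).
    rewrite Ne; exists (fun j => if j == i then 1 else 0).
    rewrite (bigD1 i) //= eqxx rscale1 big1 ?addr0 // => j /negPf ->.
    by apply/funext => k; rewrite /rscale mulr0.
  exists n, (fun i => HMod (NH _ (eN i))) => x; rewrite -NP Ne.
  split=> [[c ce]|[c ->]]; last by exists c; rewrite E.
  by exists c; apply: hval_inj; rewrite E.
exists n, (fun i => hval (e i)); apply/seteqP; split=> x.
  move=> Nx; have := Nx; rewrite -[x]/(hval (HMod (NH _ Nx))) => /NP/Pe[c ce].
  by exists c; rewrite ce E.
by move=> [c ->]; rewrite -E; apply/NP/Pe; exists c.
Qed.

(** The analogue on [hmod] of [represents]. *)
Definition hrepresents (P : lmodType A^c) (N : H -> Prop) := exists phi : P -> H,
  [/\ linear phi, injective phi & forall x, N x <-> exists p, phi p = x].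

Lemma representsP (P : lmodType A^c) N (N' : H -> Prop) : N `<=` HA ->
  (forall x, N (hval x) <-> N' x) -> represents P N <-> hrepresents P N'.
Proof.
move=> NH NN'; split=> [[phi [lphi [fphi iphi sphi]]]|[phi [lphi iphi sphi]]].
  have Nphi p : N (phi p) by exact: fphi.
  exists (fun p => HMod (NH _ (Nphi p))); split.
  - by move=> a p q; apply: hval_inj; exact: lphi.
  - by move=> p q /(congr1 (@hval _ _)) /= e; apply: iphi; rewrite ?inE.
  - move=> x; rewrite -NN'; split=> [/sphi[p _ e]|[p <-]]; last exact: Nphi.
    by exists p; apply: hval_inj.
exists (fun p => hval (phi p)); split.
  by move=> a p q; rewrite lphi.
split.
- by move=> p _ /=; apply/NN'/sphi; exists p.
- by move=> p q _ _ /hval_inj/iphi.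
- move=> x Nx; have := Nx; rewrite -[x]/(hval (HMod (NH _ Nx))) => /NN'/sphi[p e].
  by exists p => //; rewrite e.
Qed.

Lemma fin_gen_hset (P : H -> Prop) : fin_gen (hset P) <-> fg_pred P.
Proof. by apply: fin_genP; [exact: hset_HA|exact: hset_hval]. Qed.

Lemma represents_hset (P : lmodType A^c) (N : H -> Prop) :
  represents P (hset N) <-> hrepresents P N.
Proof. by apply: representsP; [exact: hset_HA|exact: hset_hval]. Qed.

End Bridge.

(** * Finitely generated complemented submodules are projective *)

(** The fixed points of Q, which are its image when Q is idempotent. *)
Record fixmod (R : realType) (A : cstarAlgType R) (Q : hmod A -> hmod A)
  (lQ : linear Q) := FixMod { fval : hmod A; fvalP : Q fval = fval }.

Section FixedModule.
Context {R : realType} {A : cstarAlgType R}.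
Local Notation H := (hmod A).
Variables (Q : H -> H) (lQ : linear Q).
Local Notation W := (fixmod lQ).

HB.instance Definition _ := gen_eqMixin W.
HB.instance Definition _ := gen_choiceMixin W.

Lemma fval_inj : injective (@fval R A Q lQ).
Proof.
by move=> [x hx] [y hy] /= e; case: y / e hy => hy; congr FixMod; exact: Prop_irrelevance.
Qed.

Lemma fixD (x y : W) : Q (fval x + fval y) = fval x + fval y.
Proof. by rewrite (linD lQ) !fvalP. Qed.
Lemma fixN (x : W) : Q (- fval x) = - fval x.
Proof. by rewrite (linN lQ) fvalP. Qed.
Lemma fixZ (a : A^c) (x : W) : Q (a *: fval x) = a *: fval x.
Proof. by rewrite (linZ lQ) fvalP. Qed.

Definition fzero : W := FixMod lQ (lin0 lQ).
Definition fadd (x y : W) : W := FixMod lQ (fixD x y).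
Definition fopp (x : W) : W := FixMod lQ (fixN x).
Definition fscale (a : A^c) (x : W) : W := FixMod lQ (fixZ a x).

Lemma faddA : associative fadd.
Proof. by move=> x y z; apply: fval_inj; exact: addrA. Qed.
Lemma faddC : commutative fadd.
Proof. by move=> x y; apply: fval_inj; exact: addrC. Qed.
Lemma fadd0 : left_id fzero fadd.
Proof. by move=> x; apply: fval_inj; exact: add0r. Qed.
Lemma faddN : left_inverse fzero fopp fadd.
Proof. by move=> x; apply: fval_inj; exact: addNr. Qed.

HB.instance Definition _ := GRing.isZmodule.Build W faddA faddC fadd0 faddN.

Lemma fscaleA (a b : A^c) x : fscale a (fscale b x) = fscale (a * b) x.
Proof. by apply: fval_inj; exact: scalerA. Qed.
Lemma fscale1 : left_id 1 fscale.
Proof. by move=> x; apply: fval_inj; exact: scale1r. Qed.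
Lemma fscaleDr : right_distributive fscale +%R.
Proof. by move=> a x y; apply: fval_inj; exact: scalerDr. Qed.
Lemma fscaleDl x : {morph fscale^~ x : a b / a + b}.
Proof. by move=> a b; apply: fval_inj; exact: scalerDl. Qed.

HB.instance Definition _ := GRing.Zmodule_isLmodule.Build A^c W
  fscaleA fscale1 fscaleDr fscaleDl.

Lemma fval_lin : linear (@fval R A Q lQ).
Proof. by []. Qed.

Hypothesis bQ : bdd Q.
Hypothesis QQ : forall x, Q (Q x) = Q x.
Hypothesis fgQ : fg_pred (fun x => Q x = x).

Definition fproj (x : H) : W := FixMod lQ (QQ x).

Lemma fixmod_fg : finitely_generated W.
Proof.
have [n [e He]] := fgQ; exists n, (fun i => fproj (e i)) => x.
have /He [c ce] := fvalP x; exists c; apply: fval_inj.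
rewrite (lin_sum fval_lin) -{1}[fval x]fvalP ce (lin_sum lQ).
by apply: eq_bigr => i _; rewrite (linZ lQ).
Qed.

(** A lift of h is found on the dual basis and extended by the coordinate
    forms. *)
Lemma fixmod_projective : projective W.
Proof.
have [n [e He]] := fgQ.
have [|m [r [Qr xr]]] := dual_basis (n := n) (e := e) lQ bQ QQ.
  by move=> x; apply/He; exact: QQ.
move=> M N g h lg lh sg.
have /choice [mm gm] (i : 'I_m) : exists y, g y = h (fproj (r i)) by exact: sg.
exists (fun x => \sum_(i < m) (hval (fval x) i : A^c) *: mm i); split.
  move=> a x y; rewrite scaler_sumr -big_split; apply: eq_bigr => i _.
  by rewrite /= scalerA -scalerDl.
move=> x; rewrite (lin_sum lg).
have {2}-> : x = \sum_(i < m) (hval (fval x) i : A^c) *: fproj (r i).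
  apply: fval_inj; rewrite (lin_sum fval_lin) {1}(xr _ (fvalP x)).
  by apply: eq_bigr => i _; rewrite (linZ fval_lin) /= Qr.
rewrite (lin_sum lh); apply: eq_bigr => i _.
by rewrite (linZ lg) (linZ lh) gm.
Qed.

Theorem fg_complement_projective : exists P : fgprojType A^c,
  hrepresents P (fun x => Q x = x).
Proof.
exists (FGProj fixmod_fg fixmod_projective), (@fval R A Q lQ); split.
- exact: fval_lin.
- exact: fval_inj.
- move=> x; split=> [Qx|[p <-]]; last exact: fvalP.
  by exists (FixMod lQ Qx).
Qed.

End FixedModule.

(** * Openness of the semi-Fredholm classes *)

Section SemiFredholm.
Context {R : realType} {A : cstarAlgType R}.
Local Notation H := (hmod A).
Implicit Types (F : Ba A) (G : H -> H) (k : K0 A^c).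

Lemma hrep_eq P (N N' : H -> Prop) : (forall x, N x <-> N' x) ->
  hrepresents P N -> hrepresents P N'.
Proof.
by move=> NN [phi [l i s]]; exists phi; split=> // x; rewrite -NN.
Qed.

Lemma hrep_iso P (N : H -> Prop) (U V : H -> H) : linear V ->
  cancel U V -> cancel V U -> hrepresents P N -> hrepresents P (fun x => N (U x)).
Proof.
move=> lV UV VU [phi [l i s]]; exists (fun p => V (phi p)); split.
- by move=> a p q; rewrite l lV.
- by move=> p q /(can_inj VU)/i.
- move=> x; rewrite s; split=> [[p e]|[p <-]]; last by exists p; rewrite VU.
  by exists p; rewrite e UV.
Qed.

Lemma hrep_splits (P : lmodType A^c) (Q : H -> H) : linear Q ->
  (forall x, Q (Q x) = Q x) -> hrepresents P (fun x => Q x = x) ->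
  exists i q, splits (P := P) i q Q.
Proof.
move=> lQ QQ [i [li ii Ni]].
have /choice [q qP] x : exists p, i p = Q x by apply/Ni.
exists i, q; split=> //.
- by move=> a x y; apply: ii; rewrite li !qP lQ.
- by move=> p; apply: ii; rewrite qP; apply/Ni; exists p.
Qed.

Definition bounded_outer F G := outer_inverse (Ba_hmod F) G /\ bdd G.

Definition fg_kerGF F G := fg_pred (fun x => G (Ba_hmod F x) = 0).
Definition fg_kerG G := fg_pred (fun y : H => G y = 0).

Lemma MPhi_plusP F : MPhi_plus F <-> exists G, bounded_outer F G /\ fg_kerGF F G.
Proof.
split=> [[M1 [N1 [M2 [N2 [d fN]]]]]|[G [[oG bG] fG]]].
  have [G [oG bG e1 e2]] := decomposition_outer d; exists G; split=> //.
  by apply: (fin_genP _ e1).1 fN; have [[_ []]] := d.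
do 4 eexists; split; first exact: outer_decomposition oG bG.
exact/fin_gen_hset.
Qed.

Lemma MPhi_minusP F : MPhi_minus F <-> exists G, bounded_outer F G /\ fg_kerG G.
Proof.
split=> [[M1 [N1 [M2 [N2 [d fN]]]]]|[G [[oG bG] fG]]].
  have [G [oG bG e1 e2]] := decomposition_outer d; exists G; split=> //.
  by apply: (fin_genP _ e2).1 fN; have [[_ _ _ []]] := d.
do 4 eexists; split; first exact: outer_decomposition oG bG.
exact/fin_gen_hset.
Qed.

Lemma MPhiP F : MPhi F <-> exists G, [/\ bounded_outer F G, fg_kerGF F G & fg_kerG G].
Proof.
split=> [[M1 [N1 [M2 [N2 [d f1 f2]]]]]|[G [[oG bG] f1 f2]]].
  have [G [oG bG e1 e2]] := decomposition_outer d; exists G; split=> //.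
    by apply: (fin_genP _ e1).1 f1; have [[_ []]] := d.
  by apply: (fin_genP _ e2).1 f2; have [[_ _ _ []]] := d.
do 4 eexists; split; first exact: outer_decomposition oG bG.
  exact/fin_gen_hset.
exact/fin_gen_hset.
Qed.

Lemma has_indexP F k : has_index F k <-> exists G (P1 P2 : fgprojType A^c),
  [/\ bounded_outer F G, fg_kerGF F G /\ fg_kerG G, hrepresents P1 (fun x => G (Ba_hmod F x) = 0),
      hrepresents P2 (fun y => G y = 0) & k = K0_diff P1 P2].
Proof.
split=> [[M1 [N1 [M2 [N2 [P1 [P2 [d [f1 f2] r1 r2 ->]]]]]]]|].
  have [G [oG bG e1 e2]] := decomposition_outer d; exists G, P1, P2.
  have N1H : N1 `<=` HA by have [[_ []]] := d.
  have N2H : N2 `<=` HA by have [[_ _ _ []]] := d.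
  split=> //; first by split; [exact: (fin_genP N1H e1).1|exact: (fin_genP N2H e2).1].
    exact: (representsP _ N1H e1).1.
  exact: (representsP _ N2H e2).1.
move=> [G [P1 [P2 [[oG bG] [f1 f2] r1 r2 ->]]]].
do 4 eexists; exists P1, P2; split; first exact: outer_decomposition oG bG.
- split; first exact/fin_gen_hset.
  exact/fin_gen_hset.
- exact/represents_hset.
- exact/represents_hset.
- by [].
Qed.

Lemma MPhi_has_index F : MPhi F -> exists k, has_index F k.
Proof.
move=> /MPhiP[G [[oG bG] f1 f2]]; have lF := Ba_hmod_lin F; have lG := oG.1.
have bF := Ba_hmod_bdd F.
have [P1 r1] : exists P : fgprojType A^c, hrepresents P (fun x => x - G (Ba_hmod F x) = x).
  apply: fg_complement_projective.
  - exact: compl_lin (comp_lin lF lG).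
  - exact: bddB bdd_id (bdd_comp bG bF).
  - by move=> x; exact: outer_idem1.
  - by apply: fg_pred_eq f1 => x; exact (@outer_ker1 _ _ (Ba_hmod F) G x).
have [P2 r2] : exists P : fgprojType A^c, hrepresents P (fun y => y - Ba_hmod F (G y) = y).
  apply: fg_complement_projective.
  - exact: compl_lin (comp_lin lG lF).
  - exact: bddB bdd_id (bdd_comp bF bG).
  - by move=> x; exact: outer_idem2.
  - by apply: fg_pred_eq f2 => x; exact (@outer_ker2 _ _ (Ba_hmod F) G x lF oG).
exists (K0_diff P1 P2); apply/has_indexP; exists G, P1, P2; split=> //.
  by apply: hrep_eq r1 => x; apply: iff_sym; exact (@outer_ker1 _ _ (Ba_hmod F) G x).
by apply: hrep_eq r2 => x; apply: iff_sym; exact (@outer_ker2 _ _ (Ba_hmod F) G x lF oG).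
Qed.

Lemma has_index_MPhi F k : has_index F k -> MPhi F.
Proof.
by move=> /has_indexP[G [_ [_ [pG [f1 f2] _ _ _]]]]; apply/MPhiP; exists G.
Qed.

Theorem has_index_uniq F k k' : has_index F k -> has_index F k' -> k = k'.
Proof.
move=> /has_indexP[G [P1 [P2 [[oG bG] _ r1 r2 ->]]]].
move=> /has_indexP[G' [P1' [P2' [[oG' bG'] _ r1' r2' ->]]]].
have lF := Ba_hmod_lin F; have lG := oG.1; have lG' := oG'.1.
have s1 G0 (P : lmodType A^c) : outer_inverse (Ba_hmod F) G0 -> hrepresents P (fun x => G0 (Ba_hmod F x) = 0) ->
    exists i q, splits (P := P) i q (fun x => x - G0 (Ba_hmod F x)).
  move=> oG0 r; apply: hrep_splits.
  - exact: compl_lin (comp_lin lF oG0.1).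
  - by move=> x; exact: outer_idem1.
  - by apply: hrep_eq r => x; exact (@outer_ker1 _ _ (Ba_hmod F) G0 x).
have s2 G0 (P : lmodType A^c) : outer_inverse (Ba_hmod F) G0 -> hrepresents P (fun x => G0 x = 0) ->
    exists i q, splits (P := P) i q (fun x => x - Ba_hmod F (G0 x)).
  move=> oG0 r; apply: hrep_splits.
  - exact: compl_lin (comp_lin oG0.1 lF).
  - by move=> x; exact: outer_idem2.
  - by apply: hrep_eq r => x; exact (@outer_ker2 _ _ (Ba_hmod F) G0 x lF oG0).
have [i1 [q1 S1]] := s1 _ _ oG r1; have [i2 [q2 S2]] := s2 _ _ oG r2.
have [i1' [q1' S1']] := s1 _ _ oG' r1'; have [i2' [q2' S2']] := s2 _ _ oG' r2'.
apply/K0_diffP; exists (fgproj_sum P2 P1').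
exact: index_invariance lF oG oG' S1 S2 S1' S2'.
Qed.

Lemma fredholm_indexE F k : has_index F k -> fredholm_index F = k.
Proof.
move=> Fk; rewrite /fredholm_index; case: pselect => [h|[]]; last by exists k.
by case: (cid h) => k' /= Fk'; exact: has_index_uniq Fk.
Qed.

Definition close_to F (e : R) F' := forall x, hn (Ba_hmod F' x - Ba_hmod F x) <= e * hn x.

(** The radius 1 / (2 (c + 1)), where c bounds G, makes G (F' - F) at most 1/2
    in norm. *)
Theorem bounded_outer_perturb F G : bounded_outer F G ->
  exists2 e : R, 0 < e & forall F', close_to F e F' ->
  exists G' U V, [/\ bounded_outer F' G', forall y, G' y = 0 <-> G y = 0,
    linear V, cancel U V /\ cancel V U &
    forall x, G' (Ba_hmod F' x) = 0 <-> G (Ba_hmod F (U x)) = 0].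
Proof.
move=> [oG [c c0 Gc]]; have lG := oG.1.
have c1 : 0 < c + 1 by lra.
exists (2 * (c + 1))^-1 => [|F' FF']; first by rewrite invr_gt0 mulr_gt0.
have lF := Ba_hmod_lin F; have lF' := Ba_hmod_lin F'.
pose K x := G (Ba_hmod F' x - Ba_hmod F x).
have lK : linear K.
  by move=> a x y; rewrite /K lF lF' -lG; congr G; rewrite scalerBr; zmodule.
have K2 x : hn (K x) <= 2^-1 * hn x.
  apply: (le_trans (Gc _)); apply: (@le_trans _ _ (c * ((2 * (c + 1))^-1 * hn x))).
    by rewrite ler_wpM2l.
  have -> : c * ((2 * (c + 1))^-1 * hn x) = c / (c + 1) * (2^-1 * hn x).
    by field; rewrite gt_eqF.
  rewrite ler_piMl ?mulr_ge0 ?invr_ge0 ?hn_ge0 // ler_pdivrMr // mul1r; lra.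
have [V [lV bV KV VK]] := neumann lK K2.
have [oG' k2 k1] := outer_perturb lF lF' oG lV VK KV.
exists (fun y => V (G y)), (fun x => x + K x), V; split=> //.
split=> //; apply: bdd_comp => //; by exists c.
Qed.

Lemma fg_kerGF_perturb F G F' G' U V : linear V -> cancel U V -> cancel V U ->
  (forall x, G' (Ba_hmod F' x) = 0 <-> G (Ba_hmod F (U x)) = 0) ->
  fg_kerGF F G -> fg_kerGF F' G'.
Proof.
move=> lV UV VU e f; have := fg_pred_iso lV UV VU f.
by apply: fg_pred_eq => x; apply: iff_sym; exact: e.
Qed.

Lemma fg_kerG_eq G G' : (forall y, G' y = 0 <-> G y = 0) -> fg_kerG G -> fg_kerG G'.
Proof. by move=> e; apply: fg_pred_eq => y; apply: iff_sym; exact: e. Qed.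

Lemma MPhi_plus_minus F : MPhi_plus F -> MPhi_minus F -> MPhi F.
Proof.
move=> /MPhi_plusP[G [[oG bG] f1]] /MPhi_minusP[G' [[oG' bG'] f2]].
have [f2' _] := semi_fredholm_both (Ba_hmod_lin F) oG oG' f1 f2.
by apply/MPhiP; exists G.
Qed.

Lemma MPhi_plus_and_minus F : MPhi F -> MPhi_plus F /\ MPhi_minus F.
Proof.
move=> /MPhiP[G [pG f1 f2]].
by split; [apply/MPhi_plusP|apply/MPhi_minusP]; exists G.
Qed.

Definition norm_open (C : Ba A -> Prop) :=
  forall F, C F -> exists2 e : R, 0 < e & forall F', close_to F e F' -> C F'.

(** A perturbation in MPhi would have a finitely generated N2 for the inherited
    outer inverse too, and this N2 is that of F. *)
Theorem MPhi_plus_only_open : norm_open (MPhi_plus `\` MPhi).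
Proof.
move=> F [/MPhi_plusP[G [pG f1]] notMPhi].
have [e e0 He] := bounded_outer_perturb pG; exists e => // F' /He.
move=> [G' [U [V [pG' k2 lV [UV VU] k1]]]]; split.
  by apply/MPhi_plusP; exists G'; split=> //; exact: fg_kerGF_perturb k1 f1.
move=> /MPhi_plus_and_minus[_ /MPhi_minusP[G'' [[oG'' _] f2]]]; apply: notMPhi.
apply/MPhiP; exists G; split=> //.
have [f2' _] := semi_fredholm_both (Ba_hmod_lin F') pG'.1 oG''
  (fg_kerGF_perturb lV UV VU k1 f1) f2.
by apply: fg_kerG_eq f2' => y; apply: iff_sym; exact: k2.
Qed.

Theorem MPhi_minus_only_open : norm_open (MPhi_minus `\` MPhi).
Proof.
move=> F [/MPhi_minusP[G [pG f2]] notMPhi].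
have [e e0 He] := bounded_outer_perturb pG; exists e => // F' /He.
move=> [G' [U [V [pG' k2 lV [UV VU] k1]]]]; split.
  by apply/MPhi_minusP; exists G'; split=> //; exact: fg_kerG_eq k2 f2.
move=> /MPhi_plus_and_minus[/MPhi_plusP[G'' [[oG'' _] f1]] _]; apply: notMPhi.
apply/MPhiP; exists G; split=> //.
have [_ f1'] := semi_fredholm_both (Ba_hmod_lin F') oG'' pG'.1 f1 (fg_kerG_eq k2 f2).
have lU : linear U.
  by move=> a x y; rewrite -[RHS]VU lV !UV.
apply: (@fg_kerGF_perturb F' G' F G V U lU VU UV _ f1') => x.
by rewrite k1 VU.
Qed.

Theorem has_index_open k : norm_open (fun F => has_index F k).
Proof.
move=> F /has_indexP[G [P1 [P2 [pG [f1 f2] r1 r2 ->]]]].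
have [e e0 He] := bounded_outer_perturb pG; exists e => // F' /He.
move=> [G' [U [V [pG' k2 lV [UV VU] k1]]]]; apply/has_indexP.
exists G', P1, P2; split=> //.
- by split; [exact: fg_kerGF_perturb k1 f1|exact: fg_kerG_eq k2 f2].
- have := hrep_iso lV UV VU r1.
  by apply: hrep_eq => x; apply: iff_sym; exact: k1.
- by apply: hrep_eq r2 => y; apply: iff_sym; exact: k2.
Qed.

End SemiFredholm.

(** * Invariance along paths *)

Section Homotopy.
Context {R : realType} {A : cstarAlgType R}.
Local Notation H := (hmod A).
Implicit Types (F : Ba A).

(** The supremum defining [opnorm] is finite because both operators are
    bounded. *)
Lemma opnorm_close F F' (e : R) :
  opnorm (fun x => F' x - F x) < e -> close_to F e F'.
Proof.
set S := [set l2norm (F' x - F x) | x in [set x | HA x /\ l2norm x <= 1]].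
move=> Fe; have lF := Ba_hmod_lin F; have lF' := Ba_hmod_lin F'.
have supS : has_sup S.
  split.
    exists (l2norm (F' 0 - F 0)), 0; split=> //; first exact: HA0.
    by rewrite -[l2norm _]/(hn (0 : H)) hn0.
  have [c c0 Hc] := bddB (Ba_hmod_bdd F') (Ba_hmod_bdd F).
  exists c => _ [x [hx x1] <-]; pose z : H := HMod hx.
  by apply: (le_trans (Hc z)); rewrite ler_piMr.
have unit_le (z : H) : hn z <= 1 -> hn (Ba_hmod F' z - Ba_hmod F z) <= e.
  move=> z1; apply: le_trans (ltW Fe); apply: ub_le_sup; first by case: supS.
  by exists (hval z) => //; split=> //; exact: hvalP.
have e0 : 0 <= e.
  by apply: le_trans (unit_le 0 _); rewrite ?hn_ge0 // hn0.
move=> x; have [x0|/hn0_eq0 ->] := ltP 0 (hn x); last first.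
  by rewrite (lin0 lF) (lin0 lF') subrr hn0 mulr0.
set y := hr (hn x)^-1 x.
have xE : x = hr (hn x) y by rewrite hrA divff ?hr1 // gt_eqF.
have -> : Ba_hmod F' x - Ba_hmod F x = hr (hn x) (Ba_hmod F' y - Ba_hmod F y).
  by rewrite hrBr -(hr_lin _ _ lF') -(hr_lin _ _ lF) -xE.
rewrite mulrC; apply: (le_trans (hn_hr _ (ltW x0))).
rewrite ler_wpM2l ?(ltW x0) //.
apply: unit_le; apply: (le_trans (hn_hr _ _)); first by rewrite invr_ge0 ltW.
by rewrite mulVf // gt_eqF.
Qed.

Lemma norm_continuous_close (f : R -> Ba A) (I : set R) t e :
  norm_continuous_on I f -> I t -> 0 < e ->
  exists2 d : R, 0 < d & forall s, I s -> `|t - s| < d -> close_to (f t) e (f s).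
Proof.
move=> fc It e0; have /cvgrPdist_lt /(_ _ e0) := fc t It.
rewrite /prop_near1 /nbhs /= /within /= => /nbhs_ballP[d d0 Hd].
exists d => // s Is ts; apply: opnorm_close.
have := Hd s ts Is; rewrite sub0r normrN => /(le_lt_trans (ler_norm _)); exact.
Qed.

(** The set where P holds is both open and closed in the interval. *)
Lemma locally_constant01 (P : R -> Prop) :
  (forall t, 0 <= t <= 1 -> exists2 d : R, 0 < d &
     forall s, 0 <= s <= 1 -> `|t - s| < d -> (P t <-> P s)) ->
  P 0 -> P 1.
Proof.
move=> loc P0; pose I := `[(0 : R), 1]%classic.
have IE t : I t <-> 0 <= t <= 1 by rewrite /I /= in_itv.
(* The union of the balls on whose trace on I the property Q holds. *)
pose O (Q : R -> Prop) := \bigcup_(w in [set w : R * R |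
   forall s, I s -> `|w.1 - s| < w.2 -> Q s]) ball w.1 w.2.
have openO Q : open (O Q) by apply: bigcup_open => w _; exact: ball_open.
have OQ Q t : I t -> O Q t -> Q t.
  by move=> It [[c e] /= h ct]; apply: h.
have OP t : I t -> P t -> O P t.
  move=> /[dup] It /IE/loc[d d0 Hd] Pt; exists (t, d) => /=; last exact: ballxx.
  by move=> s /IE Is ts; apply/(Hd s Is ts).
have ONP t : I t -> ~ P t -> O (fun s => ~ P s) t.
  move=> /[dup] It /IE/loc[d d0 Hd] Pt; exists (t, d) => /=; last exact: ballxx.
  by move=> s /IE Is ts Ps; apply: Pt; apply/(Hd s Is ts).
have : (I `&` P) = I.
  apply: (@segment_connected R 0 1).
  - by exists 0; split => //; apply/IE; rewrite lexx ler01.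
  - exists (O P); first exact: openO.
    apply/seteqP; split=> t [It Pt]; split=> //; [exact: OP|exact: OQ].
  - exists (~` O (fun s => ~ P s)); first exact: open_closedC.
    apply/seteqP; split=> t [It Pt]; split=> //.
      by move=> /(OQ (fun s => ~ P s) t It).
    by apply: contrapT => nP; apply: Pt; exact: ONP.
move=> e; have : I 1 by apply/IE; rewrite lexx ler01.
by rewrite -e => -[].
Qed.

(** Near a time at which the path is outside C it stays in an open class
    disjoint from C, so membership in C is locally constant. *)
Lemma path_invariant (f : R -> Ba A) (C : Ba A -> Prop) :
  norm_continuous_on `[0, 1] f ->
  norm_open C ->
  (forall t : R, 0 <= t <= 1 -> ~ C (f t) ->
     exists D : Ba A -> Prop, [/\ norm_open D, D (f t) & forall F, D F -> ~ C F]) ->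
  C (f 0) -> C (f 1).
Proof.
move=> fc oC nC; apply: (@locally_constant01 (fun t => C (f t))) => t It.
have It' : `[(0 : R), 1]%classic t by rewrite /= in_itv.
have [D [oD Dt DC]] : exists D : Ba A -> Prop, [/\ norm_open D, D (f t) &
    forall F, D F -> (C (f t) <-> C F)].
  have [Ct|/[dup] nCt /(nC t It)[D [oD Dt DC]]] := pselect (C (f t)).
    by exists C.
  by exists D; split=> // F /DC nCF; split.
have [e e0 He] := oD _ Dt.
have [d d0 Hd] := norm_continuous_close fc It' e0.
exists d => // s Is ts; apply: DC; apply: He; by apply: Hd.
Qed.

Lemma MPhi_pm_cases F : MPhi_pm F ->
  [\/ (MPhi_plus `\` MPhi) F, (MPhi_minus `\` MPhi) F | exists k, has_index F k].
Proof.
have [/MPhi_has_index|nF] := pselect (MPhi F); first by constructor 3.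
by move=> [|] ?; [constructor 1|constructor 2].
Qed.

End Homotopy.

Theorem corollary4p3 (R : realType) (A : cstarAlgType R) (f : R -> Ba A)
  (f_continuous : norm_continuous_on `[0, 1] f)
  (f_MPhi_pm : forall t : R, 0 <= t <= 1 -> MPhi_pm (f t)) :
  [/\ (MPhi_plus `\` MPhi) (f 0) -> (MPhi_plus `\` MPhi) (f 1),
      (MPhi_minus `\` MPhi) (f 0) -> (MPhi_minus `\` MPhi) (f 1)
    & MPhi (f 0) -> MPhi (f 1) /\ fredholm_index (f 0) = fredholm_index (f 1)].
Proof.
have disj (F : Ba A) : (MPhi_plus `\` MPhi) F -> ~ (MPhi_minus `\` MPhi) F.
  by move=> [Fp nF] [Fm _]; apply/nF/MPhi_plus_minus.
split.
- apply: path_invariant => //; first exact: MPhi_plus_only_open.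
  move=> t /f_MPhi_pm/MPhi_pm_cases[|mF _|[k Fk] _] //.
    exists (MPhi_minus `\` MPhi); split=> //; first exact: MPhi_minus_only_open.
    by move=> F mF' /disj.
  exists (fun F => has_index F k); split=> //; first exact: has_index_open.
  by move=> F /has_index_MPhi MF [].
- apply: path_invariant => //; first exact: MPhi_minus_only_open.
  move=> t /f_MPhi_pm/MPhi_pm_cases[pF _|//|[k Fk] _].
    exists (MPhi_plus `\` MPhi); split=> //; first exact: MPhi_plus_only_open.
  exists (fun F => has_index F k); split=> //; first exact: has_index_open.
  by move=> F /has_index_MPhi MF [].
- move=> /MPhi_has_index[k F0].
  have F1 : has_index (f 1) k.
    apply: (@path_invariant _ _ f (fun F => has_index F k)) F0 => //.
      exact: has_index_open.
    move=> t /f_MPhi_pm/MPhi_pm_cases[pF _|mF _|[l Fl] nFk].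
    + exists (MPhi_plus `\` MPhi); split=> //; first exact: MPhi_plus_only_open.
      by move=> F [_ nF] /has_index_MPhi.
    + exists (MPhi_minus `\` MPhi); split=> //; first exact: MPhi_minus_only_open.
      by move=> F [_ nF] /has_index_MPhi.
    + exists (fun F => has_index F l); split=> //; first exact: has_index_open.
      by move=> F Fl' Fk; apply: nFk; rewrite (has_index_uniq Fk Fl').
  by split; [exact: has_index_MPhi F1|rewrite (fredholm_indexE F0) (fredholm_indexE F1)].
Qed.
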